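(* Let $r\ge 1$ and $q\ge r+1$ be integers. Then the number $Z(q,G)$ of proper $q$-colorings of $r$-regular graphs satisfies $$\lim_{g\to\infty}\ \sup_{G\in\mathcal{G}(n,g,r)}\left|\frac{\log Z(q,G)}{n}-\log\Big[q\Big(1-\frac1q\Big)^{\frac r2}\Big]\right|=0,$$ where the supremum is over all $n\ge1$ and all $G\in\mathcal{G}(n,g,r)$.
   Context: Graphs are finite and simple. $Z(q,G)$ is the number of proper $q$-colorings of $G$, i.e. of maps from the node set to $\{1,\dots,q\}$ giving different values to adjacent nodes. The girth is the length of a shortest cycle ($\infty$ if there is none). $\mathcal{G}(n,g,r)$ is the set of all $r$-regular graphs with $n$ nodes and girth at least $g$. *)

(* Defs.v *)
From mathcomp Require Import all_boot all_order all_algebra.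
From mathcomp Require Import all_classical all_reals all_analysis.

Set Implicit Arguments.
Unset Strict Implicit.
Unset Printing Implicit Defensive.

Import Order.TTheory GRing.Theory Num.Theory.
Import numFieldNormedType.Exports.

Local Open Scope classical_set_scope.
Local Open Scope ring_scope.

Record sgraph := SGraph {
  node :> finType;
  adj : rel node;
  adj_sym : symmetric adj;
  adj_irr : irreflexive adj
}.

Definition regular (r : nat) (G : sgraph) : Prop :=
  forall x : G, #|[set y : G | adj x y]%SET| = r.

(* [path.cycle] also accepts [::], [:: x; y] with x adjacent to y, and
   closed walks with repeated nodes, whence the extra conditions. *)
Definition graph_cycle (G : sgraph) (c : seq G) : Prop :=
  (3 <= size c)%N /\ ucycle (@adj G) c.

(* The infimum of the empty set is +oo, so forests have infinite girth. *)
Definition girth (R : realType) (G : sgraph) : \bar R :=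
  ereal_inf [set ((size c)%:R)%:E | c in [set c : seq G | graph_cycle c]].

Definition graph_class (R : realType) (n g r : nat) (G : sgraph) : Prop :=
  [/\ #|G| = n, regular r G & ((g%:R)%:E <= girth R G)%E].

Definition proper_coloring (q : nat) (G : sgraph)
    (f : {ffun G -> 'I_q}) : bool :=
  [forall x, forall y, adj x y ==> (f x != f y)].

Definition num_colorings (q : nat) (G : sgraph) : nat :=
  #|[set f : {ffun G -> 'I_q} | proper_coloring f]%SET|.

(* Main.v *)
Require Import Defs.
From HB Require Import structures.
From mathcomp Require Import all_boot all_order all_algebra.
From mathcomp Require Import fingroup perm.
From mathcomp Require Import all_classical all_reals all_analysis.
From mathcomp Require Import ring lra zify.

Set Implicit Arguments.
Unset Strict Implicit.
Unset Printing Implicit Defensive.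

Import Order.TTheory GRing.Theory Num.Theory.
Import numFieldNormedType.Exports.

Local Open Scope classical_set_scope.
Local Open Scope ring_scope.

(** Build a graph of the class edge by edge.  Adding the edge uv to a partial
    graph H multiplies the number of proper q-colourings by the probability
    that u and v receive different colours in a uniform proper colouring of H.
    By the girth condition u and v are far apart in H, and the ball of radius
    about g/2 around u in H is a tree in which u has at most d = r - 1
    neighbours and the other vertices have at most d children.  If the colour
    of u is nearly uniform whatever the colours outside of this ball are, each
    edge contributes a factor 1 - 1/q up to a relative error that depends on g
    only ([monochromatic_ratio]).  There are n r / 2 edges and the empty graph
    has q^n colourings; taking logarithms gives the limit ([telescope],
    [log_density_close]).

    The near uniformity is a statement about trees.  Summing out the colours of
    a tree from the outermost level to the root, each vertex sends to its parent
    the law p of its colour, and the law at a vertex with children p_1 .. p_k is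
    proportional to prod_i (1 - p_i(c)) ([boundary_marginal]).  So it must be
    shown that this recursion forgets its initial values when k <= d <= q - 2
    ([message_converges]).

    The recursion contracts the Hellinger distance to the uniform law, that is,
    the sum of (sqrt(q p(c)) - 1)^2.  The reason is visible for large q: with
    x = q p, a message averaging its children at X is, before normalisation,
    exp(1 - X), and in the coordinate s = sqrt x the map
    s |-> exp((1 - s^2) / 2) is 1-Lipschitz because s^2 exp(1 - s^2) <= 1.
    Going from one child to several uses that (s - 1)^2 is a convex function of
    ln (1 - p) ([hellinger_convex]), and normalising is a radial projection to a
    sphere through the uniform law ([normalized_hellinger]).  For finite q
    the Lipschitz constant improves to about 1 - 1/q, the radial projection may
    expand a little, and the gain exceeds the loss ([contraction_constant],
    [hellinger_contraction]).  All this needs messages of order 1/q, which two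
    rounds of the recursion provide ([bp_le_half], [bp_le_uniform_order]).

    A supremum over the empty set would be -oo, so the limit also requires an
    r-regular graph of girth at least g for all r and g; a Cayley graph is
    given at the end ([exists_regular_large_girth]). *)

(** * Scalar inequalities behind the contraction *)

Lemma mean_value_between (R : realType) (f df : R -> R) (lo hi s t : R) :
  (forall x, lo <= x <= hi -> is_derive x 1 f (df x)) ->
  lo <= s <= hi -> lo <= t <= hi -> s != t ->
  exists c, [/\ lo <= c <= hi, (c - s) * (t - c) > 0
             & f t - f s = df c * (t - s)].
Proof.
move=> fdf.
wlog st : s t / s < t.
  move=> H hs ht nst; have [st|ts] : s < t \/ t < s.
    by apply/orP; rewrite -neq_lt.
    exact: H.
  have [|c [hc c1 c2]] := H _ _ ts ht hs; first by rewrite eq_sym.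
  exists c; split=> //; first lra.
  by rewrite -opprB c2 -mulrN opprB.
move=> hs ht _.
have [x xst||c cst ->] := @MVT R f df s t st.
- apply: fdf; move: xst; rewrite in_itv/=; lra.
- apply: derivable_within_continuous => x xst.
  suff : is_derive x 1 f (df x) by case.
  apply: fdf; move: xst; rewrite in_itv/=; lra.
- exists c; move: cst; rewrite in_itv/= => /andP[c1 c2]; split=> //; first lra.
  by rewrite mulr_gt0 ?subr_gt0.
Qed.

Lemma derive_sign_ge (R : realType) (f df : R -> R) (lo hi s t : R) :
  (forall x, lo <= x <= hi -> is_derive x 1 f (df x)) ->
  (forall x, lo <= x <= hi -> 0 <= df x * (x - s)) ->
  lo <= s <= hi -> lo <= t <= hi -> f s <= f t.
Proof.
move=> fdf sgn hs ht; have [->//|st] := eqVneq s t.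
have [c [hc c1 e]] := mean_value_between fdf hs ht st.
rewrite -subr_ge0 e; have := sgn c hc.
have [cs|cs|cs] := ltgtP c s; last by move: c1; rewrite cs subrr mul0r ltxx.
- have tc : t < c by move: c1; rewrite nmulr_rgt0 ?subr_lt0.
  by rewrite nmulr_lge0 ?subr_lt0// => h; rewrite mulr_le0// subr_le0 ltW// (lt_trans tc).
- have tc : c < t by move: c1; rewrite pmulr_rgt0 ?subr_gt0.
  by rewrite pmulr_lge0 ?subr_gt0// => h; rewrite mulr_ge0// subr_ge0 ltW// (lt_trans _ tc).
Qed.

(** The quadratic remainder has the constant 1/2 of the Taylor expansion, up to
    the factor 1 / (1 - zm); the weaker bound z^2 / (1 - z) would be too lossy in
    [hellinger_contraction] for few colours. *)
Lemma ln_1B_lower (R : realType) (zm z : R) : 0 <= zm -> zm < 1 -> z <= zm ->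
  - z - z ^+ 2 / (2 * (1 - zm)) <= ln (1 - z).
Proof.
move=> zm0 zm1 zzm; rewrite -subr_ge0.
pose C := (1 - zm)^-1.
have C1 : C * (1 - zm) = 1 by rewrite mulVf//; lra.
have C0 : 0 < C by rewrite invr_gt0; lra.
pose f x : R := ln (1 - x) + x + C / 2 * (x * x).
have := @derive_sign_ge R f (fun x => - (1 - x)^-1 + 1 + C * x)
  (Num.min z 0) zm 0 z.
have -> : f 0 = 0 by rewrite /f subr0 ln1; lra.
have -> : f z = ln (1 - z) - (- z - z ^+ 2 / (2 * (1 - zm))).
  by rewrite /f invfM -/C expr2; lra.
apply.
- move=> x /andP[_ xzm]; rewrite /f.
  have x1 : 0 < 1 - x by lra.
  have h : is_derive (1 - x) 1 (@ln R) (1 - x)^-1 by apply: is_derive1_ln.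
  apply: is_derive_eq.
  rewrite /GRing.scale/=; lra.
- move=> x /andP[_ xzm].
  have x1 : 0 < 1 - x by lra.
  have -> : (- (1 - x)^-1 + 1 + C * x) * (x - 0) = (1-x)^-1 * (x^+2 * (C * (1 - x) - 1)).
    by field; lra.
  apply: mulr_ge0; first by rewrite invr_ge0 ltW.
  by apply: mulr_ge0; [exact: sqr_ge0 | nra].
- by rewrite zm0 andbT ge_min lexx orbT.
- by rewrite zzm andbT ge_min lexx.
Qed.

(** Tangent line inequality for (s - 1)^2 as a function of ln (q - s^2): the
    slope -(s - 1) (q - s^2) / s of this function decreases in s as long as
    s t (s + t - 1) <= q, which the bound on mu guarantees. *)
Lemma hellinger_convex (R : realType) (q mu s t : R) :
  0 < mu -> mu ^+ 2 < q -> mu ^+ 2 * (2 * mu - 1) <= q ->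
  0 < s <= mu -> 0 < t <= mu ->
  (t - 1) ^+ 2 + (t - 1) * (q - t ^+ 2) / t * (ln (q - t ^+ 2) - ln (q - s ^+ 2))
    <= (s - 1) ^+ 2.
Proof.
move=> mu0 muq hmu hs ht; rewrite -subr_ge0.
pose D x : R := (x - 1) * (q - x ^+ 2) / x.
pose f x : R := (x - 1) * (x - 1) + D t * ln (q - x * x).
have := @derive_sign_ge R f (fun x => 2 * (x - 1) + D t * ((q - x ^+ 2)^-1 * (- (2 * x))))
  (Num.min s t) mu t s.
have -> : (f t <= f s) = (0 <= (s - 1) ^+ 2 -
   ((t - 1) ^+ 2 + D t * (ln (q - t ^+ 2) - ln (q - s ^+ 2)))).
  by rewrite -subr_ge0 /f !expr2; congr (_ <= _); lra.
apply.
- move=> x /andP[mx xmu]; rewrite /f.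
  have x0 : 0 < x by apply: lt_le_trans mx; rewrite lt_min; lra.
  have x1 : 0 < q - x * x by nra.
  have h : is_derive (q - x * x) 1 (@ln R) (q - x * x)^-1 by apply: is_derive1_ln.
  apply: is_derive_eq.
  rewrite /GRing.scale/= !expr2; lra.
- move=> x /andP[mx xmu].
  have x0 : 0 < x by apply: lt_le_trans mx; rewrite lt_min; lra.
  have x1 : 0 < q - x ^+ 2 by rewrite expr2; nra.
  have -> : (2 * (x - 1) + D t * ((q - x ^+ 2)^-1 * (- (2 * x)))) * (x - t)
     = (q - x ^+ 2)^-1 * (2 / t) * ((x - t) ^+ 2 * (q - x * t * (x + t - 1))).
    rewrite /D; field; rewrite !gt_eqF//; lra.
  apply: mulr_ge0; first by rewrite mulr_ge0 ?invr_ge0 ?divr_ge0; lra.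
  apply: mulr_ge0; first exact: sqr_ge0.
  have h1 : x * t <= mu ^+ 2 by rewrite expr2; nra.
  have h2 : x + t - 1 <= 2 * mu - 1 by lra.
  have [h3|h3] := leP 0 (x + t - 1); last by nra.
  have : x * t * (x + t - 1) <= mu ^+ 2 * (2 * mu - 1); last lra.
  by apply: ler_pM => //; nra.
- by rewrite ge_min lexx orbT; lra.
- by rewrite ge_min lexx; lra.
Qed.

(** Put a = (n + 1 - x) / n, so that a <= exp(- (x - 1) / n).  Dividing by a^2, the
    left-hand side is at most (n - 1)^2 x exp(- th (x - 1)) with th = 1 - 3/n;
    its maximum over x is (n - 1)^2 exp(- 3/n) / th, and
    exp(3/n) >= (1 + 1/n)^3 reduces the claim to a polynomial inequality in n. *)
Lemma large_contraction_constant (R : realType) (n : nat) (N := n%:R : R) x :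
  (6 <= n)%N -> 0 < x < N + 1 ->
  (N - 1) ^+ 2 * x * ((N + 1 - x) / N) ^+ n.-1
    <= (1 - 3 / (4 * N)) * (N + 1 - x) ^+ 2.
Proof.
move=> n6 /andP[x0 x1].
have N6 : 6 <= N by rewrite /N ler_nat.
pose a := (N + 1 - x) / N; rewrite -/a.
have a0 : 0 < a by rewrite divr_gt0; lra.
have -> : N + 1 - x = a * N by rewrite /a divfK// gt_eqF; lra.
have -> : n.-1 = (n - 3 + 2)%N by lia.
rewrite exprD (exprMn 2 a N).
set X := a ^+ (n - 3).
have n3 : (n - 3)%:R = N - 3 :> R by rewrite natrB//; lia.
pose th := (N - 3) / N.
have key : th * x * X * (1 + 1 / N) ^+ 3 <= 1.
  have h1 : X <= expR (- (th * (x - 1))).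
    have -> : - (th * (x - 1)) = (n - 3)%:R * (- ((x - 1) / N)).
      by rewrite n3 /th; field; rewrite gt_eqF; lra.
    rewrite expRM_natl; apply: lerXn2r; rewrite ?nnegrE ?expR_ge0 ?(ltW a0)//.
    have -> : a = 1 - (x - 1) / N by rewrite /a; field; rewrite gt_eqF; lra.
    exact: expR_ge1Dx.
  have h2 : th * x <= expR (th * x - 1).
    by apply: le_trans (expR_ge1Dx _); lra.
  have h3 : (1 + 1 / N) ^+ 3 <= expR (3%:R * (1 / N)).
    rewrite expRM_natl; apply: lerXn2r; rewrite ?nnegrE ?expR_ge0//.
      by rewrite addr_ge0 ?divr_ge0//; lra.
    exact: expR_ge1Dx.
  have e1 : 1 = expR (th * x - 1) * expR (- (th * (x - 1))) * expR (3%:R * (1 / N)) :> R.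
    rewrite -!expRD -[LHS]expR0; congr expR.
    by rewrite /th; field; rewrite gt_eqF; lra.
  rewrite [leRHS]e1.
  have th0 : 0 <= th by rewrite divr_ge0; lra.
  have X0 : 0 <= X by rewrite exprn_ge0// ltW.
  apply: ler_pM => //.
  - by rewrite mulr_ge0// mulr_ge0// ltW.
  - by rewrite exprn_ge0// addr_ge0// divr_ge0//; lra.
  - by apply: ler_pM => //; rewrite mulr_ge0// ltW.
have -> : (N - 1) ^+ 2 * x * (X * a ^+ 2) = a ^+ 2 * ((N - 1) ^+ 2 * (x * X)) by lra.
have -> : (1 - 3 / (4 * N)) * (a ^+ 2 * N ^+ 2) = a ^+ 2 * ((1 - 3 / (4 * N)) * N ^+ 2) by lra.
apply: ler_wpM2l; first exact: sqr_ge0.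
set Y := x * X in key *.
have Y0 : 0 <= Y by rewrite mulr_ge0 ?exprn_ge0 ?ltW.
have keyY : (N - 3) * (N + 1) ^+ 3 * Y <= N ^+ 4.
  have N0 : 0 < N ^+ 4 by rewrite exprn_gt0; lra.
  rewrite -[leRHS]mul1r -ler_pdivrMr//.
  apply: le_trans key; rewrite -/Y le_eqVlt; apply/orP; left; apply/eqP.
  rewrite /th /Y; field; rewrite gt_eqF; lra.
have -> : (1 - 3 / (4 * N)) * N ^+ 2 = (4 * N - 3) * N / 4.
  by field; rewrite gt_eqF; lra.
have P0 : 0 < (N - 3) * (N + 1) ^+ 3 by rewrite mulr_gt0 ?exprn_gt0; lra.
rewrite -(ler_pM2l P0).
apply: (@le_trans _ _ ((N - 1) ^+ 2 * N ^+ 4)).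
  have -> : (N - 3) * (N + 1) ^+ 3 * ((N - 1) ^+ 2 * Y) = (N - 1) ^+ 2 * ((N - 3) * (N + 1) ^+ 3 * Y) by lra.
  by apply: ler_wpM2l => //; exact: sqr_ge0.
rewrite -subr_ge0.
have -> : (N - 3) * (N + 1) ^+ 3 * ((4 * N - 3) * N / 4) - (N - 1) ^+ 2 * N ^+ 4 =
  N / 4 * (5 * N ^+ 4 - 28 * N ^+ 3 - 14 * N ^+ 2 + 12 * N + 9) by field.
apply: mulr_ge0; first lra.
have -> : N = (N - 6) + 6 by lra.
have : 0 <= N - 6 by lra.
move: (N - 6) => u u0; have := exprn_ge0 2 u0; have := exprn_ge0 3 u0; have := exprn_ge0 4 u0.
nra.
Qed.

(** Here n = q - 1.  The constant k bounds the squared Lipschitz constant of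
    [power_contraction] on the range of the messages; the condition on k ^+ 2 says
    that it beats the loss of the radial projection estimated by
    [sum_ln_lower].  For n <= 5 the constant k comes from the maximum of
    x ((n + 1 - x) / n)^(n - 3) over the range, rounded up when n = 5. *)
Lemma contraction_constant (R : realType) (n : nat) (N := n%:R : R) :
  (2 <= n)%N ->
  exists2 k : R, 0 <= k /\
    k ^+ 2 < 1 - (N - 1) * (3 * N - 1) / (2 * N * (N + 1) ^+ 2) &
    forall x, 0 < x <= 4 * (N + 1) / (N + 5) ->
      (N - 1) ^+ 2 * x * ((N + 1 - x) / N) ^+ n.-1 <= k * (N + 1 - x) ^+ 2.
Proof.
rewrite /N {N} => n2.
have [n6|] := leqP 6 n; last first.
  case: n n2 => [|[|[|[|[|[|n]]]]]] // _ _ /=.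
  - exists (2 / 3).
      split; first lra.
      by rewrite [ltRHS](_ : _ = 31 / 36); [lra | field].
    move=> x /andP[x0]; rewrite ler_pdivlMr => [x1|]; last lra.
    rewrite expr1; nra.
  - exists (8 / 9).
      split; first lra.
      by rewrite [ltRHS](_ : _ = 5 / 6); [lra | field].
    move=> x /andP[x0]; rewrite ler_pdivlMr => [x1|]; last lra.
    rewrite -subr_ge0.
    suff : 0 <= (4 - x) ^+ 2 * (8 / 9 - 4 / 9 * x) by lra.
    by rewrite mulr_ge0 ?sqr_ge0//; lra.
  - exists (225 / 256).
      split; first lra.
      by rewrite [ltRHS](_ : _ = 167 / 200); [lra | field].
    move=> x /andP[x0]; rewrite ler_pdivlMr => [x1|]; last lra.
    rewrite -subr_ge0.
    suff : 0 <= (5 - x) ^+ 2 * (9 / 64 * (5 / 2 - x) ^+ 2) by lra.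
    by rewrite mulr_ge0 ?sqr_ge0// mulr_ge0 ?sqr_ge0//; lra.
  - exists (17 / 20).
      split; first lra.
      by rewrite [ltRHS](_ : _ = 38 / 45); [lra | field].
    move=> x /andP[x0]; rewrite ler_pdivlMr => [x1|]; last lra.
    rewrite -subr_ge0.
    suff : 0 <= (6 - x) ^+ 2 * (17 / 20 - 16 / 625 * x * (6 - x) ^+ 2) by lra.
    have h : 0 <= (x - 2) ^+ 2 * (8 - x) by rewrite mulr_ge0 ?sqr_ge0//; lra.
    apply: mulr_ge0; first exact: sqr_ge0.
    suff -> : 17 / 20 - 16 / 625 * x * (6 - x) ^+ 2 =
        16 / 625 * ((x - 2) ^+ 2 * (8 - x)) + 77 / 2500 by lra.
    by field.
set N := n%:R.
have N6 : 6 <= N by rewrite /N ler_nat.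
exists (1 - 3 / (4 * N)); last first.
  move=> x /andP[x0 x1]; apply: large_contraction_constant => //.
  rewrite x0/=; apply: le_lt_trans x1 _.
  rewrite ltr_pdivrMr; nra.
split.
  by rewrite subr_ge0 ler_pdivrMr; nra.
rewrite -subr_gt0.
have -> : 1 - (N - 1) * (3 * N - 1) / (2 * N * (N + 1) ^+ 2) - (1 - 3 / (4 * N)) ^+ 2
  = (71 * N ^+ 2 - 2 * N - 9) / (16 * N ^+ 2 * (N + 1) ^+ 2).
  by field; rewrite !gt_eqF; lra.
apply: divr_gt0; first nra.
by rewrite mulr_gt0 ?mulr_gt0 ?exprn_gt0; lra.
Qed.

(** With y(s) = ((N + 1 - s^2) / N)^((N - 1) / 2) one has y(1) = 1, and the
    hypothesis on k is exactly the bound y'^2 <= k.  This is the effect of N - 1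
    identical children. *)
Lemma power_contraction (R : realType) (n : nat) (N := n%:R : R) (k mu s : R) :
  (2 <= n)%N -> 1 <= mu -> mu ^+ 2 < N + 1 ->
  (forall x, 0 < x <= mu ^+ 2 ->
      (N - 1) ^+ 2 * x * ((N + 1 - x) / N) ^+ n.-1 <= k * (N + 1 - x) ^+ 2) ->
  0 < s <= mu ->
  (expR ((N - 1) / 2 * ln ((N + 1 - s ^+ 2) / N)) - 1) ^+ 2 <= k * (s - 1) ^+ 2.
Proof.
move=> n2 mu1 muq hk hs.
have N2 : 2 <= N by rewrite /N ler_nat.
pose y x : R := expR ((N - 1) / 2 * ln ((N + 1 - x * x) * N^-1)).
pose dy x : R := - ((N - 1) * x / (N + 1 - x ^+ 2)) * y x.
have y1 : y 1 = 1.
  by rewrite /y mulr1 addrK divff ?ln1 ?mulr0 ?expR0// gt_eqF; lra.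
have [->|s1] := eqVneq s 1.
  have N0 : N != 0 by rewrite gt_eqF; lra.
  by rewrite expr1n addrK divff// ln1 mulr0 expR0 subrr expr0n/= mulr0.
have pos x : 0 < x <= mu -> 0 < N + 1 - x ^+ 2 by rewrite !expr2 in muq *; nra.
have [x hx||||c [hc _ e]] := @mean_value_between R y dy (Num.min s 1) mu 1 s.
- have hx' : 0 < x <= mu.
    by case/andP: hx => h1 h2; rewrite h2 andbT (lt_le_trans _ h1)// lt_min; lra.
  have := pos _ hx'; rewrite expr2 => px.
  have h : is_derive ((N + 1 - x * x) * N^-1) 1 (@ln R) ((N + 1 - x * x) * N^-1)^-1.
    by apply: is_derive1_ln; rewrite divr_gt0//; lra.
  rewrite /y; apply: is_derive_eq.
  rewrite /dy /y /GRing.scale/= !expr2; field; rewrite !gt_eqF//; lra.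
- by rewrite mu1 andbT ge_min lexx orbT.
- by case/andP: hs => _ ->; rewrite andbT ge_min lexx.
- by rewrite eq_sym.
have hc' : 0 < c <= mu.
  by case/andP: hc => h1 h2; rewrite h2 andbT (lt_le_trans _ h1)// lt_min; lra.
have -> : expR ((N - 1) / 2 * ln ((N + 1 - s ^+ 2) / N)) - 1 = y s - y 1.
  by rewrite y1 /y expr2.
rewrite e exprMn; apply: ler_wpM2r; first exact: sqr_ge0.
have pc := pos _ hc'.
have ys : y c ^+ 2 = ((N + 1 - c ^+ 2) / N) ^+ n.-1.
  rewrite /y -expRM_natl mulrA.
  have -> : 2%:R * ((N - 1) / 2) = n.-1%:R :> R.
    by rewrite -[in RHS]subn1 natrB ?(ltnW n2)//; field.
  rewrite expRM_natl lnK ?expr2// posrE divr_gt0// -?expr2//; lra.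
rewrite /dy exprMn ys sqrrN expr_div_n exprMn.
have -> : (N - 1) ^+ 2 * c ^+ 2 / (N + 1 - c ^+ 2) ^+ 2 * ((N + 1 - c ^+ 2) / N) ^+ n.-1
  = ((N - 1) ^+ 2 * c ^+ 2 * ((N + 1 - c ^+ 2) / N) ^+ n.-1) / (N + 1 - c ^+ 2) ^+ 2.
  by rewrite mulrAC.
rewrite ler_pdivrMr ?exprn_gt0//; apply: hk.
by case/andP: hc' => c0 cm; rewrite exprn_gt0//= lerXn2r// ?nnegrE; lra.
Qed.

Lemma sum_seq_const (R : nzRingType) (T : Type) (r : seq T) (x : R) :
  \sum_(i <- r) x = (size r)%:R * x.
Proof. by rewrite big_const_seq count_predT iter_addr_0 mulr_natl. Qed.

(** The convexity of [hellinger_convex] replaces the children by N - 1 copies of a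
    single one, at the geometric mean of the numbers (N + 1 - s^2) / N. *)
Lemma full_family_contraction (R : realType) (n : nat) (N := n%:R : R) (k mu : R)
    (ss : seq R) :
  (2 <= n)%N -> 1 <= mu -> mu ^+ 2 < N + 1 -> mu ^+ 2 * (2 * mu - 1) <= N + 1 ->
  (forall x, 0 < x <= mu ^+ 2 ->
      (N - 1) ^+ 2 * x * ((N + 1 - x) / N) ^+ n.-1 <= k * (N + 1 - x) ^+ 2) ->
  0 <= k -> size ss = n.-1 -> (forall s, s \in ss -> 0 < s <= mu) ->
  (expR (2^-1 * \sum_(s <- ss) ln ((N + 1 - s ^+ 2) / N)) - 1) ^+ 2
    <= k / (N - 1) * \sum_(s <- ss) (s - 1) ^+ 2.
Proof.
move=> n2 mu1 muq muc hk k0 szs hss.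
have N2 : 2 <= N by rewrite /N ler_nat.
have szN : (size ss)%:R = N - 1 :> R by rewrite szs -subn1 natrB// ltnW.
pose a s := (N + 1 - s ^+ 2) / N.
pose S := \sum_(s <- ss) ln (a s); rewrite -/S.
have sq s : 0 < s <= mu -> 0 < s ^+ 2 <= mu ^+ 2.
  by case/andP=> s0 sm; rewrite exprn_gt0//= lerXn2r// ?nnegrE; lra.
have a0 s : 0 < s <= mu -> 0 < a s.
  by move=> /sq h; rewrite divr_gt0; lra.
pose l := S / (N - 1).
have lS : (N - 1) * l = S by rewrite /l mulrC divfK// gt_eqF; lra.
(* This bound is strict to make the coordinate sb below positive. *)
have l_up : l < ln ((N + 1) / N).
  rewrite /l ltr_pdivrMr; last lra.
  rewrite mulrC -szN -sum_seq_const /S big_seq [ltRHS]big_seq.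
  apply: ltr_sum.
    have : (0 < size ss)%N by rewrite szs; lia.
    by case: (ss) => // s t _; rewrite /= mem_head.
  move=> s /hss hs; have := a0 _ hs; have /andP[h1 h2] := sq _ hs => h3.
  rewrite ltr_ln ?posrE// ?divr_gt0//; [|lra|lra].
  by rewrite /a ltr_pM2r ?invr_gt0; lra.
have l_lo : ln ((N + 1 - mu ^+ 2) / N) <= l.
  rewrite /l ler_pdivlMr; last lra.
  rewrite mulrC -szN -sum_seq_const /S big_seq [leRHS]big_seq.
  apply: ler_sum => s /hss hs; have := a0 _ hs; have /andP[h1 h2] := sq _ hs => h3.
  rewrite ler_ln ?posrE// ?divr_gt0//; [|lra|lra].
  by rewrite /a ler_pM2r ?invr_gt0; lra.
pose ab := expR l.
have ab_up : ab < (N + 1) / N.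
  by rewrite -[ltRHS]lnK ?ltr_expR// posrE divr_gt0; lra.
have ab_lo : (N + 1 - mu ^+ 2) / N <= ab.
  by rewrite -[leLHS]lnK ?ler_expR// posrE divr_gt0; lra.
rewrite ltr_pdivlMr in ab_up; last lra.
rewrite ler_pdivrMr in ab_lo; last lra.
(* The coordinate of the single child that replaces the family. *)
pose sb := Num.sqrt (N + 1 - ab * N).
have sb2 : sb ^+ 2 = N + 1 - ab * N by rewrite sqr_sqrtr; lra.
have hsb : 0 < sb <= mu.
  rewrite sqrtr_gt0; apply/andP; split; first lra.
  rewrite -(@ler_pXn2r _ 2) ?nnegrE ?sqrtr_ge0//; last lra.
  by rewrite sb2; lra.
have asb : a sb = ab by rewrite /a sb2; field; rewrite gt_eqF; lra.
have -> : 2^-1 * S = (N - 1) / 2 * ln (a sb).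
  by rewrite asb expRK -lS; lra.
apply: le_trans (power_contraction n2 mu1 muq hk hsb) _.
rewrite -mulrA; apply: ler_wpM2l => //.
rewrite mulrC ler_pdivlMr; last lra.
rewrite mulrC -szN -sum_seq_const.
pose D := (sb - 1) * (N + 1 - sb ^+ 2) / sb.
have -> : \sum_(i <- ss) (sb - 1) ^+ 2 =
  \sum_(s <- ss) ((sb - 1) ^+ 2 + D * (ln (a sb) - ln (a s))).
  have e0 : \sum_(s <- ss) D * (ln (a sb) - ln (a s)) = 0.
    by rewrite -mulr_sumr sumrB sum_seq_const szN asb /ab expRK -/S lS subrr mulr0.
  by rewrite big_split/= e0 addr0.
rewrite big_seq [leRHS]big_seq; apply: ler_sum => s /hss hs.
have /andP[h1 h2] := sq _ hs.
have -> : ln (a sb) - ln (a s) = ln (N + 1 - sb ^+ 2) - ln (N + 1 - s ^+ 2).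
  have /andP[h3 h4] := sq _ hsb.
  rewrite /a !lnM ?posrE ?invr_gt0; try lra.
apply: (@hellinger_convex _ _ mu) => //; lra.
Qed.

(** A missing child acts as a child with s = 1, that is, with the uniform law. *)
Lemma family_contraction (R : realType) (n : nat) (N := n%:R : R) (k mu : R)
    (ss : seq R) :
  (2 <= n)%N -> 1 <= mu -> mu ^+ 2 < N + 1 -> mu ^+ 2 * (2 * mu - 1) <= N + 1 ->
  (forall x, 0 < x <= mu ^+ 2 ->
      (N - 1) ^+ 2 * x * ((N + 1 - x) / N) ^+ n.-1 <= k * (N + 1 - x) ^+ 2) ->
  0 <= k -> (size ss <= n.-1)%N -> (forall s, s \in ss -> 0 < s <= mu) ->
  (expR (2^-1 * \sum_(s <- ss) ln ((N + 1 - s ^+ 2) / N)) - 1) ^+ 2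
    <= k / (N - 1) * \sum_(s <- ss) (s - 1) ^+ 2.
Proof.
move=> n2 mu1 muq muc hk k0 szs hss.
have N0 : N != 0 by rewrite pnatr_eq0; lia.
pose r := nseq (n.-1 - size ss) (1 : R).
have := @full_family_contraction R n k mu (ss ++ r) n2 mu1 muq muc hk k0.
rewrite size_cat size_nseq subnKC// => /(_ erefl).
have e1 : \sum_(s <- r) ln ((N + 1 - s ^+ 2) / N) = 0.
  rewrite big1_seq// => s /andP[_ /nseqP[-> _]].
  by rewrite expr1n addrK divff// ln1.
have e2 : \sum_(s <- r) (s - 1) ^+ 2 = 0.
  by rewrite big1_seq// => s /andP[_ /nseqP[-> _]]; rewrite subrr expr0n.
rewrite !big_cat/= -/N e1 e2 !addr0.
apply => s; rewrite mem_cat => /orP[/hss//|/nseqP[-> _]].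
by rewrite ltr01.
Qed.

(** * The message recursion *)

Definition distribution (R : realType) q (p : {ffun 'I_q -> R}) :=
  (forall c, 0 <= p c) /\ \sum_c p c = 1.

(** The probability that all neighbours avoid the colour c, when their
    colours are independent with laws ps. *)
Definition cavity (R : realType) q (ps : seq {ffun 'I_q -> R}) (c : 'I_q) : R :=
  \prod_(p <- ps) (1 - p c).

(** One step of belief propagation: the law of the colour of a vertex given
    the laws ps of the colours of its children in their own subtrees. *)
Definition bp (R : realType) q (ps : seq {ffun 'I_q -> R}) : {ffun 'I_q -> R} :=
  [ffun c => cavity ps c / \sum_b cavity ps b].

(** Up to a factor, the squared Hellinger distance from p to the uniform law. *)
Definition hellinger (R : realType) q (p : {ffun 'I_q -> R}) : R :=
  \sum_c (Num.sqrt (q%:R * p c) - 1) ^+ 2.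

Lemma distribution_le1 (R : realType) q (p : {ffun 'I_q -> R}) c :
  distribution p -> p c <= 1.
Proof.
move=> [p0 <-]; rewrite (bigD1 c)//= lerDl sumr_ge0// => i _; exact: p0.
Qed.

Lemma point_distribution (R : realType) q (a : 'I_q) :
  distribution ([ffun c => (c == a)%:R] : {ffun 'I_q -> R}).
Proof.
split=> [c|]; first by rewrite ffunE.
under eq_bigr do rewrite ffunE.
by rewrite (bigD1 a)//= eqxx big1 ?addr0// => c /negbTE ->.
Qed.

Lemma cavity_ge0 (R : realType) q (ps : seq {ffun 'I_q -> R}) c :
  (forall p, p \in ps -> distribution p) -> 0 <= cavity ps c.
Proof.
move=> h; rewrite /cavity big_seq prodr_ge0// => p /h hp.
by rewrite subr_ge0 distribution_le1.
Qed.

Lemma cavity_le1 (R : realType) q (ps : seq {ffun 'I_q -> R}) c :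
  (forall p, p \in ps -> distribution p) -> cavity ps c <= 1.
Proof.
move=> h; rewrite /cavity big_seq; apply: prodr_ile1 => p /h hp.
by rewrite subr_ge0 distribution_le1//= gerBl; case: hp.
Qed.

Lemma cavity_union_bound (R : realType) q (ps : seq {ffun 'I_q -> R}) c :
  (forall p, p \in ps -> distribution p) -> 1 - \sum_(p <- ps) p c <= cavity ps c.
Proof.
rewrite /cavity; elim: ps => [|p ps IH] h; first by rewrite !big_nil subr0.
rewrite !big_cons.
have hp : distribution p by apply: h; rewrite mem_head.
have h' p' : p' \in ps -> distribution p' by by move=> ip; apply: h; rewrite inE ip orbT.
have := IH h'; have := cavity_ge0 c h'; have := cavity_le1 c h'; rewrite /cavity.
have := distribution_le1 c hp; case: hp => /(_ c).
move: (p c) (\prod_(j <- ps) _) (\sum_(j <- ps) _) => x y z; nra.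
Qed.

Lemma sum_other_colors (R : realType) q (ps : seq {ffun 'I_q -> R}) c :
  (forall p, p \in ps -> distribution p) ->
  \sum_(b | b != c) \sum_(p <- ps) p b <= (size ps)%:R.
Proof.
move=> h; rewrite exchange_big/= -[leRHS]mulr1 -sum_seq_const big_seq [leRHS]big_seq.
apply: ler_sum => p /h [p0 <-]; rewrite [leRHS](bigD1 c)//= lerDr; exact: p0.
Qed.

Lemma sum_cavity_others (R : realType) n (ps : seq {ffun 'I_n.+1 -> R}) c :
  (size ps <= n.-1)%N -> (0 < n)%N -> (forall p, p \in ps -> distribution p) ->
  1 <= \sum_(b | b != c) cavity ps b.
Proof.
move=> szs n0 h.
have hn : \sum_(b : 'I_n.+1 | b != c) (1 : R) = n%:R.
  by rewrite sumr_const; congr (_ *+ _); rewrite cardC1 card_ord.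
apply: (@le_trans _ _ (\sum_(b | b != c) (1 - \sum_(p <- ps) p b))); last first.
  by apply: ler_sum => b _; exact: cavity_union_bound.
rewrite sumrB hn; have := sum_other_colors c h.
have : (size ps)%:R <= n%:R - 1 :> R by rewrite lerBrDr natr1 ler_nat; lia.
lra.
Qed.

Lemma sum_cavityE (R : realType) q (ps : seq {ffun 'I_q -> R}) c :
  \sum_b cavity ps b = cavity ps c + \sum_(b | b != c) cavity ps b.
Proof. by rewrite (bigD1 c). Qed.

Lemma sum_cavity_gt0 (R : realType) n (ps : seq {ffun 'I_n.+1 -> R}) :
  (size ps <= n.-1)%N -> (0 < n)%N -> (forall p, p \in ps -> distribution p) ->
  0 < \sum_b cavity ps b.
Proof.
move=> szs n0 h; rewrite (sum_cavityE _ ord0).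
have := sum_cavity_others ord0 szs n0 h; have := cavity_ge0 ord0 h; lra.
Qed.

Lemma bp_distribution (R : realType) n (ps : seq {ffun 'I_n.+1 -> R}) :
  (size ps <= n.-1)%N -> (0 < n)%N -> (forall p, p \in ps -> distribution p) ->
  distribution (bp ps).
Proof.
move=> szs n0 h; have S0 := sum_cavity_gt0 szs n0 h; split=> [c|].
  by rewrite ffunE divr_ge0 ?cavity_ge0// ltW.
under eq_bigr do rewrite ffunE.
by rewrite -mulr_suml divff// gt_eqF.
Qed.

(** The other colours have total cavity weight at least n - (n - 1) = 1, by the
    union bound. *)
Lemma bp_le_half (R : realType) n (ps : seq {ffun 'I_n.+1 -> R}) c :
  (size ps <= n.-1)%N -> (0 < n)%N -> (forall p, p \in ps -> distribution p) ->
  bp ps c <= 2^-1.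
Proof.
move=> szs n0 h; rewrite ffunE ler_pdivrMr ?sum_cavity_gt0//.
rewrite (sum_cavityE _ c).
have := sum_cavity_others c szs n0 h; have := cavity_le1 c h; lra.
Qed.

Lemma ln4_ge1 (R : realType) : 1 <= ln (4 : R).
Proof.
have h : ln (1 + - 2^-1 : R) <= - 2^-1 by apply: le_ln1Dx; lra.
have -> : 4 = ((1 + - 2^-1) ^+ 2)^-1 :> R by field.
rewrite lnV ?posrE ?exprn_gt0//; last lra.
rewrite lnXn; last lra.
by rewrite mulr2n; lra.
Qed.

(** On [0, 1/2] the convex function 4^(-p) lies below its chord, which is 1 - p. *)
Lemma exp_chord (R : realType) (p : R) :
  0 <= p <= 2^-1 -> expR (- (ln 4 * p)) <= 1 - p.
Proof.
move=> /andP[p0 p1].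
have t0 : 0 <= 2 * p by lra.
have t1 : 2 * p <= 1 by lra.
have := convex_expR (Itv01 t0 t1) (- (ln 4 / 2) : R) (0 : R).
rewrite !convRE/= /unstable.onem expR0 mulr0 addr0.
have -> : 2 * p * - (ln 4 / 2) = - (ln 4 * p) by lra.
move=> /le_trans; apply.
have -> : expR (- (ln 4 / 2)) = 2^-1 :> R; last lra.
have -> : 4 = 2 ^+ 2 :> R by ring.
rewrite lnXn// mulr2n.
have -> : - ((ln 2 + ln 2) / 2) = - ln (2 : R) by lra.
by rewrite expRN lnK// posrE.
Qed.

(** When all p b <= 1/2, the cavity weight of b is at least 4^(- w b), where w b is
    the sum of the p b.  Since the w b with b <> c sum up to at most n - 1,
    the tangent of 4^(- w) at w = 1 shows that the weights of these n colours
    add up to at least (n + ln 4) / 4 >= (n + 1) / 4. *)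
Lemma bp_le_uniform_order (R : realType) n (ps : seq {ffun 'I_n.+1 -> R}) c :
  (size ps <= n.-1)%N -> (0 < n)%N ->
  (forall p, p \in ps -> distribution p /\ forall b, p b <= 2^-1) ->
  bp ps c <= 4 / (n%:R + 5).
Proof.
move=> szs n0 h.
have hd p : p \in ps -> distribution p by move=> /h[].
pose w b := \sum_(p <- ps) p b; pose K := ln (4 : R).
have K1 : 1 <= K := ln4_ge1 R.
have hc b : (1 + K * (1 - w b)) / 4 <= cavity ps b.
  apply: (@le_trans _ _ (expR (- (K * w b)))).
    apply: (@le_trans _ _ (expR (K * (1 - w b)) * expR (- K))).
      have -> : expR (- K) = 4^-1 by rewrite expRN lnK// posrE.
      by rewrite ler_pM2r ?invr_gt0//; exact: expR_ge1Dx.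
    by rewrite -expRD le_eqVlt; apply/orP; left; apply/eqP; congr expR; lra.
  rewrite /cavity /w mulr_sumr -sumrN expR_sum big_seq [leRHS]big_seq.
  apply: ler_prod => p /h[[p0 _] p1].
  by rewrite expR_ge0/=; apply: exp_chord; rewrite p0 p1.
have hs : n.+1%:R / 4 <= \sum_(b | b != c) cavity ps b.
  apply: (@le_trans _ _ (\sum_(b | b != c) (1 + K * (1 - w b)) / 4)); last exact: ler_sum.
  rewrite -mulr_suml ler_pM2r ?invr_gt0// big_split/= -mulr_sumr sumrB.
  have -> : \sum_(b : 'I_n.+1 | b != c) (1 : R) = n%:R.
    by rewrite sumr_const; congr (_ *+ _); rewrite cardC1 card_ord.
  have := sum_other_colors c hd; rewrite -/w.
  have : (size ps)%:R <= n%:R - 1 :> R by rewrite lerBrDr natr1 ler_nat; lia.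
  rewrite -natr1; move: (\sum_(b | _) w b) (size ps)%:R => x y; nra.
rewrite ffunE ler_pdivrMr ?sum_cavity_gt0// (sum_cavityE _ c).
rewrite -natr1 in hs.
have := cavity_le1 c hd; have := cavity_ge0 c hd.
move: (cavity ps c) (\sum_(b | _) _) hs => x y hs x0 x1.
have N0 : 0 <= n%:R :> R by [].
rewrite mulrAC ler_pdivlMr; last lra.
nra.
Qed.

Lemma bp_gt0 (R : realType) n (ps : seq {ffun 'I_n.+1 -> R}) c :
  (size ps <= n.-1)%N -> (0 < n)%N ->
  (forall p, p \in ps -> distribution p /\ forall b, p b <= 2^-1) ->
  0 < bp ps c.
Proof.
move=> szs n0 h; have hd p : p \in ps -> distribution p by move=> /h[].
rewrite ffunE divr_gt0 ?sum_cavity_gt0// /cavity big_seq prodr_gt0// => p /h[_ /(_ c)].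
lra.
Qed.

(** * Contraction of the Hellinger distance *)

(** For a unit vector e and y <> 0 one has
    |y / |y| - e|^2 = 2 - 2 <y, e> / |y| <= |y - e|^2 / |y|, because |y| + 1 / |y| >= 2.
    Here e is the constant vector 1 and Y the norm of y, for the mean over the
    colours. *)
Lemma normalized_hellinger (R : realType) q (y : 'I_q -> R) :
  (0 < q)%N -> (forall c, 0 < y c) ->
  let Y := Num.sqrt (q%:R^-1 * \sum_c y c ^+ 2) in
  hellinger [ffun c => y c ^+ 2 / \sum_b y b ^+ 2] <= Y^-1 * \sum_c (y c - 1) ^+ 2.
Proof.
move=> q0 y0 /=; set S := \sum_c y c ^+ 2; set Y := Num.sqrt _.
have Q0 : 0 < q%:R :> R by rewrite ltr0n.
have S0 : 0 < S.
  rewrite /S (bigD1 (Ordinal q0))//= ltr_pwDl ?exprn_gt0//.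
  by rewrite sumr_ge0// => i _; exact: sqr_ge0.
have Y0 : 0 < Y by rewrite sqrtr_gt0 mulr_gt0 ?invr_gt0.
have Y2 : Y ^+ 2 = q%:R^-1 * S by rewrite sqr_sqrtr// ltW// mulr_gt0 ?invr_gt0.
have SY : S = q%:R * Y ^+ 2 by rewrite Y2 mulrA divff ?mul1r// gt_eqF.
have e c : Num.sqrt (q%:R * [ffun c => y c ^+ 2 / S] c) = y c / Y.
  have yY : 0 <= y c / Y by rewrite ltW// divr_gt0.
  rewrite ffunE -[RHS](ger0_norm yY) -sqrtr_sqr; congr Num.sqrt.
  by rewrite SY; field; rewrite !gt_eqF.
have -> : hellinger [ffun c => y c ^+ 2 / S] = \sum_c (y c / Y - 1) ^+ 2.
  by rewrite /hellinger; apply: eq_bigr => c _; rewrite e.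
pose T := \sum_c y c.
have sq1 : \sum_(c < q) (1 : R) = q%:R by rewrite sumr_const card_ord.
have -> : \sum_c (y c / Y - 1) ^+ 2 = S / Y ^+ 2 - 2 / Y * T + q%:R.
  rewrite -sq1 /S /T mulr_suml mulr_sumr -sumrB -big_split/=.
  by apply: eq_bigr => c _; field; rewrite gt_eqF.
have -> : \sum_c (y c - 1) ^+ 2 = S - 2 * T + q%:R.
  rewrite -sq1 /S /T mulr_sumr -sumrB -big_split/=.
  by apply: eq_bigr => c _; ring.
rewrite SY -subr_ge0.
have -> : Y^-1 * (q%:R * Y ^+ 2 - 2 * T + q%:R) -
   (q%:R * Y ^+ 2 / Y ^+ 2 - 2 / Y * T + q%:R) = q%:R / Y * (Y - 1) ^+ 2.
  by field; rewrite gt_eqF.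
by rewrite mulr_ge0 ?sqr_ge0// ltW// divr_gt0.
Qed.

(** The first-order terms of the logarithms cancel because p has total mass 1, and
    the second-order ones are controlled by the sum of p(c)^2, which is at most
    max p. *)
Lemma sum_ln_lower (R : realType) n (N := n%:R : R) (p : {ffun 'I_n.+1 -> R}) :
  (2 <= n)%N -> distribution p -> (forall c, p c <= 4 / (N + 5)) ->
  - ((N + 1) * (3 * N - 1) / (2 * N * (N + 1) ^+ 2)) <=
  \sum_c ln ((N + 1 - (N + 1) * p c) / N).
Proof.
move=> n2 [p0 p1] hp.
have N2 : 2 <= N by rewrite /N ler_nat.
have nN : n.+1%:R = N + 1 :> R by rewrite -natr1.
pose z c := ((N + 1) * p c - 1) / N.
(* The largest possible z c, reached when p c = 4 / (N + 5). *)
pose zm := (3 * N - 1) / (N * (N + 5)).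
have zm0 : 0 <= zm by rewrite divr_ge0 ?mulr_ge0; lra.
have ezm : 1 - zm = (N + 1) ^+ 2 / (N * (N + 5)).
  by rewrite /zm; field; rewrite !gt_eqF; lra.
have zm1 : zm < 1.
  rewrite -subr_gt0 ezm divr_gt0 ?exprn_gt0 ?mulr_gt0//; lra.
have hz c : z c <= zm.
  rewrite /z ler_pdivrMr; last lra.
  have -> : zm * N = (N + 1) * (4 / (N + 5)) - 1.
    by rewrite /zm; field; rewrite !gt_eqF; lra.
  rewrite lerD2r ler_pM2l; [exact: hp | lra].
have hl c : - z c - z c ^+ 2 / (2 * (1 - zm)) <= ln ((N + 1 - (N + 1) * p c) / N).
  have -> : (N + 1 - (N + 1) * p c) / N = 1 - z c.
    by rewrite /z; field; rewrite !gt_eqF; lra.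
  exact: ln_1B_lower.
apply: le_trans (ler_sum _ (fun c _ => hl c)).
have z1 : \sum_c z c = 0.
  rewrite /z -mulr_suml sumrB -mulr_sumr p1 sumr_const card_ord nN mulr1 subrr.
  by rewrite mul0r.
have z2 : \sum_c z c ^+ 2 <= (3 * N - 1) * (N + 1) / (N ^+ 2 * (N + 5)).
  have -> : \sum_c z c ^+ 2 = N ^- 2 * ((N + 1) ^+ 2 * (\sum_c p c ^+ 2) - (N + 1)).
    have -> : (N + 1) ^+ 2 * (\sum_c p c ^+ 2) - (N + 1) =
       (N + 1) ^+ 2 * (\sum_c p c ^+ 2) - 2 * (N + 1) * (\sum_c p c) + \sum_(c < n.+1) 1.
      by rewrite p1 sumr_const card_ord nN; lra.
    rewrite !mulr_sumr -sumrB -big_split/= mulr_sumr.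
    by apply: eq_bigr => c _; rewrite /z; field; rewrite gt_eqF; lra.
  have -> : (3 * N - 1) * (N + 1) / (N ^+ 2 * (N + 5)) =
    N ^- 2 * ((N + 1) ^+ 2 * (4 / (N + 5)) - (N + 1)).
    by field; rewrite !gt_eqF; lra.
  apply: ler_wpM2l; first by rewrite invr_ge0 exprn_ge0//; lra.
  rewrite lerD2r; apply: ler_wpM2l; first by rewrite exprn_ge0//; lra.
  rewrite -[leRHS]mulr1 -[X in _ <= _ * X]p1 mulr_sumr; apply: ler_sum => c _.
  by rewrite expr2 ler_wpM2r.
rewrite sumrB sumrN z1 oppr0 add0r lerN2 -(mulr_suml _ _ (fun c => z c ^+ 2)) ezm.
rewrite ler_pdivrMr; last by rewrite mulr_gt0 ?divr_gt0 ?exprn_gt0 ?mulr_gt0//; lra.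
apply: le_trans z2 _; rewrite le_eqVlt; apply/orP; left; apply/eqP.
by field; rewrite !gt_eqF; lra.
Qed.

(** Let y c be the square root of the cavity weight, divided by its value for
    uniform children.  By [normalized_hellinger] the new distance is at most the sum
    of (y c - 1)^2 divided by the norm Y of y.  The numerator is at most k f by
    [family_contraction].  Using exp t >= 1 + t, the mean of y^2 is at least
    1 plus the mean of 2 ln y, hence at least 1 - e by [sum_ln_lower].  So
    k / sqrt (1 - e) < 1 is a contraction ratio. *)
Lemma hellinger_contraction (R : realType) n : (2 <= n)%N ->
  exists2 rho : R, 0 <= rho < 1 & forall (f : R) (ps : seq {ffun 'I_n.+1 -> R}),
    (size ps <= n.-1)%N ->
    (forall p, p \in ps -> [/\ distribution p, forall c, 0 < p c <= 4 / (n%:R + 5)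
                               & hellinger p <= f]) ->
    0 <= f -> hellinger (bp ps) <= rho * f.
Proof.
move=> n2; pose N := n%:R : R.
have N2 : 2 <= N by rewrite /N ler_nat.
have nN : n.+1%:R = N + 1 :> R by rewrite -natr1.
have [k [k0 k1] hk] := contraction_constant R n2.
rewrite -/N in k1 hk.
set e := _ / _ in k1.
have e1 : 0 < 1 - e by apply: le_lt_trans k1; exact: sqr_ge0.
pose D := Num.sqrt (1 - e).
have D0 : 0 < D by rewrite sqrtr_gt0.
have kD : k < D.
  by rewrite -(@ltr_pXn2r _ 2) ?nnegrE ?sqrtr_ge0// sqr_sqrtr// ltW.
exists (k / D); first by rewrite divr_ge0 ?(ltW D0)//= ltr_pdivrMr// mul1r.
move=> f ps szs hps f0.
have sz : (size ps)%:R <= N - 1.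
  by rewrite lerBrDr natr1 ler_nat; apply: leq_ltn_trans szs _; rewrite ltn_predL ltnW.
pose M : R := 4 * (N + 1) / (N + 5).
(* The messages p satisfy q p c <= M, so sqrt (q p c) <= mu. *)
pose mu := Num.sqrt M.
have M1 : 1 <= M by rewrite ler_pdivlMr; lra.
have mu2 : mu ^+ 2 = M by rewrite sqr_sqrtr//; lra.
have mu1 : 1 <= mu by rewrite -[leLHS]sqrtr1 ler_wsqrtr.
have MN : M * (N + 5) = 4 * (N + 1) by rewrite divfK// gt_eqF; lra.
have mu_lt : mu ^+ 2 < N + 1 by rewrite mu2; nra.
have mu_c : mu ^+ 2 * (2 * mu - 1) <= N + 1.
  have h8 : 8 * mu <= N + 9.
    rewrite -(@ler_pXn2r _ 2) ?nnegrE; [|by []|lra|lra].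
    rewrite exprMn mu2.
    have -> : M = 4 * (N + 1) / (N + 5) by [].
    by rewrite mulrA ler_pdivrMr; nra.
  have : M * (8 * mu - 4) <= M * (N + 5) by rewrite ler_pM2l; lra.
  rewrite mu2; nra.
pose a (p : {ffun 'I_n.+1 -> R}) c := (N + 1 - (N + 1) * p c) / N.
have a_gt0 p c : p \in ps -> 0 < a p c.
  move=> /hps[_ /(_ c) /andP[pc0 pc1] _]; rewrite divr_gt0//; last lra.
  have : p c < 1 by apply: le_lt_trans pc1 _; rewrite ltr_pdivrMr; lra.
  nra.
pose y c := expR (2^-1 * \sum_(p <- ps) ln (a p c)).
have y2 c : y c ^+ 2 = \prod_(p <- ps) a p c.
  rewrite /y -expRM_natl mulrA divff// mul1r expR_sum big_seq [RHS]big_seq.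
  by apply: eq_bigr => p pp; rewrite lnK// posrE a_gt0.
have y0 c : 0 < y c := expR_gt0 _.
have bpE : bp ps = [ffun c => y c ^+ 2 / \sum_b y b ^+ 2].
  have ycav c : y c ^+ 2 = ((N + 1) / N) ^+ size ps * cavity ps c.
    rewrite y2 /cavity -count_predT -iter_mulr_1 -big_const_seq -big_split/=.
    by apply: eq_bigr => p _; rewrite /a; field; rewrite gt_eqF; lra.
  have C0 : ((N + 1) / N) ^+ size ps != 0.
    by rewrite expf_neq0// gt_eqF// divr_gt0; lra.
  apply/ffunP => c; rewrite !ffunE.
  under [in RHS]eq_bigr do rewrite ycav.
  by rewrite ycav -mulr_sumr -mulf_div divff// mul1r.
rewrite bpE.
apply: le_trans (normalized_hellinger _ y0) _ => //.
set Y := Num.sqrt _.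
have DY : D <= Y.
  rewrite ler_wsqrtr// nN.
  rewrite mulrC ler_pdivlMr; last lra.
  have sumy : \sum_c (1 + \sum_(p <- ps) ln (a p c)) <= \sum_c y c ^+ 2.
    apply: ler_sum => c _; rewrite y2.
    have -> : \prod_(p <- ps) a p c = expR (\sum_(p <- ps) ln (a p c)).
      rewrite expR_sum big_seq [RHS]big_seq.
      by apply: eq_bigr => p pp; rewrite lnK// posrE a_gt0.
    exact: expR_ge1Dx.
  apply: le_trans sumy.
  rewrite big_split/= sumr_const card_ord nN exchange_big/=.
  pose e' := (N + 1) * (3 * N - 1) / (2 * N * (N + 1) ^+ 2).
  have e'0 : 0 <= e' by rewrite divr_ge0 ?mulr_ge0 ?exprn_ge0//; lra.
  have : \sum_(p <- ps) - e' <= \sum_(p <- ps) \sum_c ln (a p c).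
    rewrite big_seq [leRHS]big_seq; apply: ler_sum => p /hps[pd pc _].
    by apply: sum_ln_lower => // c; case/andP: (pc c).
  rewrite sum_seq_const.
  have ee : e * (N + 1) = (N - 1) * e' by rewrite /e /e'; field; rewrite !gt_eqF; lra.
  move: (\sum_(p <- ps) _) (size ps)%:R sz => A B sz'; nra.
have Y0 : 0 < Y by apply: lt_le_trans DY.
have sumy : \sum_c (y c - 1) ^+ 2 <= k * f.
  have hy c : (y c - 1) ^+ 2 <=
      k / (N - 1) * \sum_(p <- ps) (Num.sqrt ((N + 1) * p c) - 1) ^+ 2.
    pose ss := [seq Num.sqrt ((N + 1) * p c) | p : {ffun 'I_n.+1 -> R} <- ps].
    have -> : y c = expR (2^-1 * \sum_(s <- ss) ln ((N + 1 - s ^+ 2) / N)).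
      rewrite /y big_map big_seq [in RHS]big_seq; congr expR; congr (_ * _).
      apply: eq_bigr => p /hps[_ /(_ c) /andP[pc0 _] _].
      by rewrite sqr_sqrtr// mulr_ge0 ?(ltW pc0)//; lra.
    have -> : \sum_(p <- ps) (Num.sqrt ((N + 1) * p c) - 1) ^+ 2 =
        \sum_(s <- ss) (s - 1) ^+ 2 by rewrite big_map.
    apply: (@family_contraction _ _ _ mu) => //; first by rewrite mu2.
      by rewrite size_map.
    move=> s /mapP[p /hps[_ /(_ c) /andP[pc0 pc1] _] ->].
    rewrite sqrtr_gt0 mulr_gt0//=; last lra.
    rewrite ler_wsqrtr// /M mulrAC [leRHS]mulrC; apply: ler_wpM2l => //; lra.
  apply: le_trans (ler_sum _ (fun c _ => hy c)) _.
  rewrite -mulr_sumr exchange_big/= -mulrA ler_wpM2l// mulrC ler_pdivrMr; last lra.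
  apply: (@le_trans _ _ (\sum_(p <- ps) f)).
    rewrite big_seq [leRHS]big_seq; apply: ler_sum => p /hps[_ _].
    by rewrite /hellinger nN.
  by rewrite sum_seq_const mulrC ler_wpM2l.
rewrite [leRHS]mulrAC [leRHS]mulrC; apply: ler_pM => //.
- by rewrite invr_ge0 ltW.
- by rewrite sumr_ge0// => c _; exact: sqr_ge0.
- by rewrite lef_pV2.
Qed.

(** [message d j p]: the law p arises at the root of a tree with at most d children
    per vertex, as a result of arbitrary laws at depth j.  Branches may end before
    depth j, since a vertex without children gets the uniform law. *)
Inductive message (R : realType) (q d : nat) : nat -> {ffun 'I_q -> R} -> Prop :=
| MessageBoundary p of distribution p : message d 0 p
| MessageStep j ps of (size ps <= d)%N & (forall p, p \in ps -> message d j p) :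
    message d j.+1 (bp ps).

Lemma message_distribution (R : realType) n d j (p : {ffun 'I_n.+1 -> R}) :
  (0 < n)%N -> (d <= n.-1)%N -> message d j p -> distribution p.
Proof.
move=> n0 dn; elim=> // {}j ps szs _ IH.
by apply: bp_distribution => //; exact: leq_trans dn.
Qed.

Lemma message_pos_bound (R : realType) n d j (p : {ffun 'I_n.+1 -> R}) :
  (0 < n)%N -> (d <= n.-1)%N -> message d j.+2 p ->
  forall c, 0 < p c <= 4 / (n%:R + 5).
Proof.
move=> n0 dn H c; inversion H as [|i ps szs hps e1 e2]; subst.
have szs' := leq_trans szs dn.
have h p' : p' \in ps -> distribution p' /\ forall b, p' b <= 2^-1.
  move=> /hps H'; split; first exact: message_distribution H'.
  move=> b; inversion H' as [|i' ps' sz' hps' e1' e2']; subst.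
  apply: bp_le_half => //; first exact: leq_trans dn.
  by move=> p'' /hps'; exact: message_distribution.
by rewrite bp_gt0// bp_le_uniform_order.
Qed.

Lemma hellinger_deviation (R : realType) n (p : {ffun 'I_n.+1 -> R}) c :
  distribution p -> (p c - n.+1%:R^-1) ^+ 2 <= 4 * hellinger p.
Proof.
move=> hp; have [p0 p1] := hp.
pose Q : R := n.+1%:R.
have Q1 : 1 <= Q by rewrite ler1n.
have Q0 : 0 < Q by lra.
apply: (@le_trans _ _ (4 * (Num.sqrt (Q * p c) - 1) ^+ 2)); last first.
  rewrite ler_pM2l// /hellinger (bigD1 c)//= lerDl sumr_ge0// => i _; exact: sqr_ge0.
have Qp : 0 <= Q * p c by rewrite mulr_ge0 ?(ltW Q0).
have := sqr_sqrtr Qp; set s := Num.sqrt _ => s2.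
have s0 : 0 <= s := sqrtr_ge0 _.
have -> : p c - Q^-1 = (s - 1) * ((s + 1) / Q).
  have -> : p c = s ^+ 2 / Q by rewrite s2; field; rewrite gt_eqF.
  by field; rewrite gt_eqF.
rewrite exprMn mulrC; apply: ler_wpM2r; first exact: sqr_ge0.
have -> : 4 = 2 ^+ 2 :> R by ring.
rewrite lerXn2r ?nnegrE//; first by rewrite divr_ge0 ?(ltW Q0)//; lra.
rewrite ler_pdivrMr//.
suff : s <= Q by lra.
rewrite -(@ler_pXn2r _ 2) ?nnegrE ?(ltW Q0)// s2 expr2 ler_pM2l//.
by apply: le_trans Q1; exact: distribution_le1.
Qed.

(** With two colours d = 0, and every message is uniform; otherwise the
    contraction applies from the second round on. *)
Lemma message_converges (R : realType) n d (eps : R) :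
  (0 < n)%N -> (d <= n.-1)%N -> 0 < eps ->
  exists J, forall j (p : {ffun 'I_n.+1 -> R}), (J <= j)%N -> message d j p ->
    forall c, `|p c - n.+1%:R^-1| <= eps.
Proof.
move=> n0 dn eps0; have [n2|] := leqP 2 n; last first.
  move=> n1; have {n1 n0} n1 : n = 1%N by apply/eqP; rewrite eqn_leq n0 -ltnS n1.
  subst n; exists 1%N => -[//|j] p _ H c.
  inversion H as [|i ps szs hps e1 e2]; subst.
  move: (leq_trans szs dn); rewrite leqn0 size_eq0 => /eqP ->.
  rewrite ffunE /cavity !big_nil.
  have -> : \sum_b \prod_(p <- ([::] : seq {ffun 'I_2 -> R})) (1 - p b) = 2.
    by under eq_bigr do rewrite big_nil; rewrite sumr_const card_ord.
  by rewrite div1r subrr normr0 ltW.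
have [rho /andP[rho0 rho1] hrho] := hellinger_contraction R n2.
pose F0 : R := n.+1%:R * (n.+1%:R + 1) ^+ 2.
have F00 : 0 <= F0 by rewrite mulr_ge0 ?sqr_ge0.
have base (p : {ffun 'I_n.+1 -> R}) : distribution p -> hellinger p <= F0.
  move=> hp; have [p0 p1] := hp.
  have hc c : (Num.sqrt (n.+1%:R * p c) - 1) ^+ 2 <= (n.+1%:R + 1) ^+ 2.
    have Qp : 0 <= n.+1%:R * p c by rewrite mulr_ge0.
    have Q1 : 1 <= n.+1%:R :> R by rewrite ler1n.
    have := sqr_sqrtr Qp; have := sqrtr_ge0 (n.+1%:R * p c); set s := Num.sqrt _ => s0 s2.
    have : s <= n.+1%:R.
      rewrite -(@ler_pXn2r _ 2) ?nnegrE// s2 expr2 ler_pM2l ?ltr0n//.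
      by apply: le_trans Q1; exact: distribution_le1.
    nra.
  apply: le_trans (ler_sum _ (fun c _ => hc c)) _.
  by rewrite sumr_const card_ord /F0 mulr_natl.
have decay j : forall p : {ffun 'I_n.+1 -> R}, message d j.+2 p -> hellinger p <= rho ^+ j * F0.
  elim: j => [|j IH] p H.
    by rewrite mul1r base//; exact: message_distribution H.
  inversion H as [|i ps szs hps e1 e2]; subst.
  rewrite exprS -mulrA; apply: hrho; first exact: leq_trans dn.
    move=> p /hps hp; split; first exact: message_distribution hp.
      exact: message_pos_bound hp.
    exact: IH.
  by rewrite mulr_ge0 ?exprn_ge0.
have [J _ hJ] : \forall j \near \oo, `|0 - geometric (4 * F0) rho j| <= eps ^+ 2.
  have := @cvg_geometric R (4 * F0) rho; rewrite ger0_norm// => /(_ rho1).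
  by move=> /cvgrPdist_le /(_ _ (exprn_gt0 2 eps0)).
exists J.+2 => -[|[|j]]// p; rewrite !ltnS => Jj hp c.
have hd : distribution p by exact: message_distribution hp.
rewrite -(@ler_pXn2r _ 2) ?nnegrE ?(ltW eps0)// real_normK ?num_real//.
apply: le_trans (hellinger_deviation c hd) _.
have := hJ _ Jj; rewrite /= sub0r normrN ger0_norm; last first.
  by rewrite !mulr_ge0 ?exprn_ge0.
apply: le_trans.
by rewrite -mulrA ler_pM2l// mulrC decay.
Qed.

(** * Balls of a graph without short cycles *)

(** The form in which the girth is used: a path joining the ends of an edge
    without using this edge closes up to a cycle.  Unlike the girth it
    mentions no distinctness of vertices, and it passes to subgraphs. *)
Definition long_detours (T : finType) (a : rel T) (g : nat) :=
  forall x y p, a x y ->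
    path [rel s t | a s t && ~~ ((s == x) && (t == y))] x p -> last x p = y ->
    (g <= (size p).+1)%N.

Section Levels.
Variables (T : finType) (e : rel T) (u : T) (L : nat).

Fixpoint ball k : {set T} :=
  if k is k'.+1 then ball k' :|: [set y | [exists x in ball k', e x y]] else [set u].

(** The distance from u truncated at L; level L collects all the vertices
    at distance at least L and those not connected to u. *)
Definition level x := find (fun k => x \in ball k) (iota 0 L).

Lemma ball_mono i j : (i <= j)%N -> ball i \subset ball j.
Proof.
elim: j => [|j IH]; first by rewrite leqn0 => /eqP ->.
rewrite leq_eqVlt ltnS => /orP[/eqP ->//|/IH h].
exact: fintype.subset_trans h (finset.subsetUl _ _).
Qed.

Lemma level_le x : (level x <= L)%N.
Proof. by rewrite -[leqRHS](size_iota 0 L) find_size. Qed.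

Lemma level_leE x j : (j < L)%N -> (level x <= j)%N = (x \in ball j).
Proof.
move=> jL; apply/idP/idP => [lj|xj].
  have hL : (level x < L)%N by apply: leq_ltn_trans jL.
  have h : has (fun k => x \in ball k) (iota 0 L) by rewrite has_find size_iota.
  have := nth_find 0%N h; rewrite nth_iota// add0n; apply: (fintype.subsetP (ball_mono lj)).
rewrite leqNgt; apply/negP => lt.
by have := before_find 0%N lt; rewrite nth_iota// add0n xj.
Qed.

Lemma level0 x : (0 < L)%N -> (level x == 0%N) = (x == u).
Proof. by move=> L0; rewrite -leqn0 level_leE// inE. Qed.

Lemma level_step x y : e x y -> (level y <= (level x).+1)%N.
Proof.
move=> exy; have [h|h] := ltnP (level x).+1 L; last exact: leq_trans (level_le y) h.
rewrite level_leE//= !inE; apply/orP; right; apply/exists_inP; exists x => //.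
by rewrite -level_leE// ltnW.
Qed.

Lemma level_parent y j : level y = j.+1 -> (j.+1 < L)%N -> exists2 x, e x y & level x = j.
Proof.
move=> ly jL; have jL' := ltnW jL.
have : y \in ball j.+1 by rewrite -level_leE// ly.
have yj : y \notin ball j by rewrite -level_leE// ly ltnn.
rewrite /= !inE (negbTE yj)/= => /exists_inP[x xj exy]; exists x => //.
apply/eqP; rewrite eqn_leq level_leE// xj/= -ltnS -ly; exact: level_step.
Qed.

Lemma descending_path x : (level x < L)%N ->
  exists p, [/\ path e u p, last u p = x, size p = level x
              & all (fun z => level z <= level x)%N p].
Proof.
move: {2}(level x) (erefl (level x)) => k; elim: k x => [|k IH] x lx xL.
  exists [::]; split=> //=; first by apply/esym/eqP; rewrite -level0 ?lx// (leq_ltn_trans _ xL).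
have [|y eyx ly] := level_parent lx; first by rewrite -lx.
have [|p [pp lp sp ap]] := IH y ly; first by rewrite ly (leq_ltn_trans _ xL)// lx.
exists (rcons p x); split.
- by rewrite rcons_path pp lp.
- by rewrite last_rcons.
- by rewrite size_rcons sp ly lx.
- rewrite all_rcons leqnn/=; apply: sub_all ap => z; rewrite ly lx => /leq_trans; apply.
  exact: leqnSn.
Qed.

Hypotheses (esym : symmetric e) (eirr : irreflexive e).

Lemma ascending_path x : (level x < L)%N ->
  exists p, [/\ path e x p, last x p = u, size p = level x
              & all (fun z => level z < level x)%N p].
Proof.
move: {2}(level x) (erefl (level x)) => k; elim: k x => [|k IH] x lx xL.
  exists [::]; split=> //=; first by apply/eqP; rewrite -level0 ?lx// (leq_ltn_trans _ xL).
have [|y eyx ly] := level_parent lx; first by rewrite -lx.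
have [|p [pp lp sp ap]] := IH y ly; first by rewrite ly (leq_ltn_trans _ xL)// lx.
exists (y :: p); split=> //=.
- by rewrite esym eyx.
- by rewrite sp ly lx.
- rewrite ly lx leqnn/=; apply: sub_all ap => z; rewrite ly => /leq_trans; apply.
  exact: leqnSn.
Qed.

(** Otherwise the edge xw could be bypassed through y, up to the root, and down
    to w.  This detour has length at most 2 level x, and its vertices after x have
    level less than that of x, or are y, so they differ from x. *)
Lemma unique_parent g x w y : long_detours e g -> (L.*2 <= g)%N ->
  (0 < level x < L)%N -> e w x -> (level w < level x)%N ->
  e x y -> (level y <= level x)%N -> y = w.
Proof.
move=> hg gL /andP[x0 xL] ewx lw exy ly; apply/eqP/negP => /negP yw.
have [p1 [pp1 lp1 sp1 ap1]] := ascending_path (leq_ltn_trans ly xL).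
have [p2 [pp2 lp2 sp2 ap2]] := descending_path (ltn_trans lw xL).
have avoid (z : T) s : path e z s -> all (fun t => t != x) (z :: s) ->
    path [rel s t | e s t && ~~ ((s == x) && (t == w))] z s.
  elim: s z => [//|t s IH] z /= /andP[ezt pt] /andP[zx ax].
  by rewrite ezt (negbTE zx)/= IH.
have exw : e x w by rewrite esym.
have := hg x w (y :: p1 ++ p2) exw.
have -> : last x (y :: p1 ++ p2) = w by rewrite /= last_cat lp1.
have -> : path [rel s t | e s t && ~~ ((s == x) && (t == w))] x (y :: p1 ++ p2).
  rewrite /= exy eqxx yw/= avoid//.
    by rewrite cat_path pp1 lp1.
  rewrite /= all_cat; apply/and3P; split.
  - by apply: contraTneq exy => ->; rewrite eirr.
  - by apply: sub_all ap1 => z lz; apply: contraTneq lz => ->; rewrite -leqNgt.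
  - by apply: sub_all ap2 => z lz; apply: contraTneq lz => ->; rewrite -ltnNge.
move=> /(_ isT erefl); rewrite /= size_cat sp1 sp2; lia.
Qed.

End Levels.

(** * Summing out a ball, level by level *)

Definition proper_for (T : finType) (e : rel T) q (f : {ffun T -> 'I_q}) :=
  [forall x, forall y, e x y ==> (f x != f y)].

(** The hypothesis [parentP] says that the ball of radius L - 1 around u is a tree.
    The colours of the vertices of level L are those of tau. *)
Section Elimination.
Variables (R : realType) (T : finType) (e : rel T) (u : T) (L n d : nat).
Variable tau : {ffun T -> 'I_n.+1}.
Hypotheses (e_sym : symmetric e) (e_irr : irreflexive e).
Hypothesis parentP : forall x w y, (0 < level e u L x < L)%N ->
  e w x -> (level e u L w < level e u L x)%N ->
  e x y -> (level e u L y <= level e u L x)%N -> y = w.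
Hypothesis L0 : (0 < L)%N.
Hypothesis degree_le : forall x, (#|[set y | e x y]%SET| <= d.+1)%N.
Hypothesis degree_root : (#|[set y | e u y]%SET| <= d)%N.
Hypotheses (n0 : (0 < n)%N) (dn : (d <= n.-1)%N).

Local Notation lev := (level e u L).

Definition children x := [seq y <- enum T | e x y && (lev y == (lev x).+1)].

(** The law of the colour of x, at level L - h, in the subtree below x. *)
Fixpoint msg h x : {ffun 'I_n.+1 -> R} :=
  if h is h'.+1 then bp [seq msg h' y | y <- children x]
  else [ffun c => (c == tau x)%:R].

Lemma lev_u : lev u = 0%N.
Proof. by apply/eqP; rewrite level0. Qed.

Lemma mem_children x y : (y \in children x) = e x y && (lev y == (lev x).+1).
Proof. by rewrite mem_filter mem_enum andbT. Qed.

Lemma size_children x : (lev x < L)%N -> (size (children x) <= d)%N.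
Proof.
move=> xL.
have sE : size (children x) = #|[set y | e x y && (lev y == (lev x).+1)]%SET|.
  have /card_uniqP <- : uniq (children x) by rewrite filter_uniq// enum_uniq.
  by apply: eq_card => y; rewrite [RHS]inE; exact: mem_children.
have [x0|x0] := posnP (lev x).
  have xu : x = u by apply/eqP; rewrite -(@level0 T e u L) ?x0.
  apply: leq_trans degree_root; rewrite sE xu.
  by apply: subset_leq_card; apply/fintype.subsetP => y; rewrite !inE => /andP[].
have [w ewx lw] : exists2 w, e w x & lev w = (lev x).-1.
  by apply: (@level_parent _ _ _ L); rewrite prednK.
rewrite sE -ltnS; apply: leq_trans (degree_le x).
apply: proper_card; apply/properP; split.
  by apply/fintype.subsetP => y; rewrite !inE => /andP[].
exists w; rewrite !inE; first by rewrite e_sym.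
by rewrite negb_and; apply/orP; right; rewrite lw; lia.
Qed.

Lemma msg_message h x : (lev x + h)%N = L -> message d h (msg h x).
Proof.
elim: h x => [|h IH] x xh.
  by constructor; exact: point_distribution.
rewrite /=; constructor.
  by rewrite size_map size_children//; lia.
move=> p /mapP[y]; rewrite mem_children => /andP[_ /eqP ly] ->; apply: IH; lia.
Qed.

Definition kids h x := [seq msg h y | y <- children x].

Definition kids_mass h x := \sum_b cavity (kids h x) b.

Lemma kids_dist h x p : (lev x + h.+1)%N = L -> p \in kids h x -> distribution p.
Proof.
move=> xh /mapP[y]; rewrite mem_children => /andP[_ /eqP ly] ->.
by apply: message_distribution (msg_message _) => //; lia.
Qed.

Lemma kids_mass_gt0 h x : (lev x + h.+1)%N = L -> 0 < kids_mass h x.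
Proof.
move=> xh; apply: sum_cavity_gt0 => //; last by move=> p; exact: kids_dist.
rewrite size_map; apply: leq_trans dn; apply: size_children; lia.
Qed.

Lemma cavity_kids h x c : (lev x + h.+1)%N = L ->
  cavity (kids h x) c = kids_mass h x * msg h.+1 x c.
Proof.
by move=> xh; rewrite /= ffunE mulrC divfK// gt_eqF// kids_mass_gt0.
Qed.

Definition proper_upto j (s : {ffun T -> 'I_n.+1}) :=
  [forall x, forall y, [&& e x y, lev x <= j & lev y <= j]%N ==> (s x != s y)].

Definition fixed_above j (s : {ffun T -> 'I_n.+1}) :=
  [forall x, (j < lev x)%N ==> (s x == tau x)].

(** Colourings of the levels up to j.  They are total functions, with the colours of
    tau above level j, so that all levels share one type; [erase] puts level j
    back to tau. *)
Definition admissible j c (s : {ffun T -> 'I_n.+1}) :=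
  [&& s u == c, fixed_above j s & proper_upto j s].

(** What remains of the number of proper colourings when the levels above j are
    summed out, with h = L - 1 - j: vertices of level j keep the
    messages of their children. *)
Definition weight j h c : R :=
  \sum_(s | admissible j c s) \prod_(x | lev x == j) cavity (kids h x) (s x).

Definition erase j (s : {ffun T -> 'I_n.+1}) : {ffun T -> 'I_n.+1} :=
  [ffun x => if lev x == j then tau x else s x].

Definition parent x := odflt u [pick w | e w x && (lev w == (lev x).-1)].

Lemma parentE x j : lev x = j.+1 -> (j.+1 < L)%N ->
  e (parent x) x /\ lev (parent x) = j.
Proof.
move=> lx jL; rewrite /parent; case: pickP => [w /andP[ewx /eqP lw]|none] /=.
  by split; rewrite // lw lx.
have [w ewx lw] := level_parent lx jL.
by have := none w; rewrite ewx lw lx eqxx.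
Qed.

Lemma admissible_erase j c s : (j.+1 < L)%N ->
  admissible j.+1 c s -> admissible j c (erase j.+1 s).
Proof.
move=> jL /and3P[/eqP suc /forallP fs /forallP ps]; apply/and3P; split.
- by rewrite ffunE lev_u suc.
- apply/forallP => x; rewrite ffunE; apply/implyP; rewrite leq_eqVlt eq_sym.
  by case: eqP => // _ /= jx; have := fs x; rewrite jx.
- apply/forallP => x; apply/forallP => y; apply/implyP => /and3P[exy lx ly].
  rewrite !ffunE (ltn_eqF (_ : lev x < j.+1)%N)// (ltn_eqF (_ : lev y < j.+1)%N)//.
  by have /forallP/(_ y) := ps x; rewrite exy (leqW lx) (leqW ly).
Qed.

(** Since level j + 1 is an independent set whose vertices have one
    neighbour each in the levels up to j, extending r to this level amounts to
    independent choices. *)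
Lemma admissible_fiber j c r s : (j.+1 < L)%N -> admissible j c r ->
  (admissible j.+1 c s && (erase j.+1 s == r)) =
  (s \in family (fun x => if lev x == j.+1 then [pred a | a != r (parent x)]
                          else pred1 (r x))).
Proof.
move=> jL /and3P[/eqP ruc /forallP fr /forallP pr]; apply/andP/familyP.
  move=> [/and3P[_ _ /forallP ps] /eqP er] x.
  case: ifPn => [/eqP lx|lx]; last by rewrite inE -er ffunE (negbTE lx).
  have [ep lp] := parentE lx jL.
  rewrite inE -er ffunE lp (ltn_eqF (ltnSn j)).
  have /forallP/(_ (parent x)) := ps x.
  by rewrite e_sym ep lx leqnn lp leqnSn.
move=> h.
have hr x : lev x != j.+1 -> s x = r x.
  by move=> lx; have := h x; rewrite (negbTE lx) inE => /eqP.
split; last first.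
  apply/eqP/ffunP => x; rewrite ffunE; case: ifPn => [/eqP lx|/hr//].
  by have := fr x; rewrite lx ltnSn => /eqP.
have hp x y : lev x = j.+1 -> e x y -> (lev y <= j.+1)%N -> s x != s y.
  move=> lx exy ly; have [ep lp] := parentE lx jL.
  have <- : parent x = y.
    by symmetry; apply: (@parentP x); rewrite ?lx ?lp.
  rewrite (hr (parent x)); last by rewrite lp ltn_eqF.
  by have := h x; rewrite lx eqxx inE.
apply/and3P; split.
- by rewrite hr ?lev_u// ruc.
- apply/forallP => x; apply/implyP => jx; rewrite hr ?gtn_eqF//.
  by have := fr x; rewrite ltnW.
- apply/forallP => x; apply/forallP => y; apply/implyP => /and3P[exy lx ly].
  have [lx'|lx'] := eqVneq (lev x) j.+1; first exact: hp.
  have [ly'|ly'] := eqVneq (lev y) j.+1; first by rewrite eq_sym hp// e_sym.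
  rewrite !hr//; have /forallP/(_ y) := pr x; rewrite exy.
  by rewrite -ltnS ltn_neqAle lx' lx -ltnS ltn_neqAle ly' ly.
Qed.

(** Summing over the colours of level j + 1 turns the law of each x into the
    probability 1 - msg x (r (parent x)) of avoiding its parent's colour;
    grouping these factors by parents gives the cavity weights of level j. *)
Lemma weight_step j h c : (j.+1 + h.+1)%N = L ->
  weight j.+1 h c = (\prod_(x | lev x == j.+1) kids_mass h x) * weight j h.+1 c.
Proof.
move=> jhL; have jL : (j.+1 < L)%N by rewrite -jhL addnS ltnS leq_addr.
rewrite /weight (partition_big (erase j.+1) (admissible j c)); last first.
  by move=> s; exact: admissible_erase.
rewrite mulr_sumr; apply: eq_bigr => r hr.
under eq_bigl do rewrite admissible_fiber//.
under eq_bigr => s _.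
  under eq_bigr => x lx do rewrite cavity_kids ?(eqP lx)//.
  rewrite big_split/=; over.
rewrite -mulr_sumr; congr (_ * _).
pose m x := msg h.+1 x.
transitivity (\prod_x \sum_(a | (if lev x == j.+1 then [pred a | a != r (parent x)]
                          else pred1 (r x)) a) (if lev x == j.+1 then m x a else 1)).
  rewrite bigA_distr_big_dep; apply: eq_bigr => s _.
  by rewrite big_mkcond.
transitivity (\prod_(x | lev x == j.+1) (1 - m x (r (parent x)))).
  rewrite [RHS]big_mkcond; apply: eq_bigr => x _; case: ifPn => lx; last first.
    by rewrite big_pred1_eq.
  have [_ <-] : distribution (m x).
    by apply: message_distribution (msg_message _) => //; rewrite (eqP lx).
  by rewrite [in RHS](bigD1 (r (parent x)))//= addrAC subrr add0r.
rewrite (partition_big parent (fun y => lev y == j)); last first.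
  by move=> x /eqP lx; have [_ ->] := parentE lx jL.
apply: eq_bigr => y /eqP ly.
rewrite /cavity /kids big_map big_filter big_enum_cond/=.
apply: eq_big => [x|x /andP[_ /eqP ->]//].
rewrite ly; apply/andP/andP.
  by move=> [/eqP lx /eqP <-]; have [-> _] := parentE lx jL; rewrite lx.
move=> [eyx /eqP lx]; rewrite lx; split=> //.
have [ep lp] := parentE lx jL.
by apply/eqP; symmetry; apply: (@parentP x); rewrite ?lx ?ly ?lp// e_sym.
Qed.

Lemma weight_root h c : h.+1 = L -> weight 0 h c = kids_mass h u * msg h.+1 u c.
Proof.
move=> hL; pose s0 : {ffun T -> 'I_n.+1} := [ffun x => if x == u then c else tau x].
rewrite -cavity_kids ?lev_u// /weight.
have adm s : admissible 0 c s = (s == s0).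
  apply/idP/eqP => [/and3P[/eqP su /forallP fs _]|->].
    apply/ffunP => x; rewrite ffunE; case: eqP => [->//|/eqP xu].
    by have := fs x; rewrite lt0n level0// xu => /eqP.
  apply/and3P; split.
  - by rewrite ffunE eqxx.
  - apply/forallP => x; rewrite lt0n level0// ffunE; apply/implyP => /negbTE ->.
    by rewrite eqxx.
  - apply/forallP => x; apply/forallP => y; rewrite !leqn0 !level0//.
    by apply/implyP => /and3P[exy /eqP xu /eqP yu]; move: exy; rewrite xu yu e_irr.
rewrite (big_pred1 s0) => [|s]; last exact: adm.
rewrite (big_pred1 u) => [|x]; last by rewrite /= level0.
by rewrite ffunE eqxx.
Qed.

Lemma weight_message j h : (j + h.+1)%N = L ->
  exists2 K : R, 0 <= K & forall c, weight j h c = K * msg L u c.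
Proof.
elim: j h => [|j IH] h jhL.
  exists (kids_mass h u) => [|c']; first by rewrite ltW// kids_mass_gt0// lev_u.
  by rewrite weight_root// -jhL.
have [|K K0 hK] := IH h.+1; first by rewrite -jhL addSnnS.
exists ((\prod_(x | lev x == j.+1) kids_mass h x) * K) => [|c'].
  rewrite mulr_ge0// prodr_ge0// => x /eqP lx; rewrite ltW// kids_mass_gt0//.
  by rewrite lx.
by rewrite weight_step// hK mulrA.
Qed.

Definition boundary_proper :=
  [forall x, forall y, [&& e x y, lev x == L & lev y == L] ==> (tau x != tau y)].

(** A colouring that agrees with tau on level L is proper if and only if it is
    proper below level L, tau is proper on level L, and the edges between the two
    are respected.  The latter condition is the cavity weight of point masses. *)
Lemma boundary_count c :
  \sum_(s : {ffun T -> 'I_n.+1} |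
     [&& proper_for e s, s u == c & [forall x, (lev x == L) ==> (s x == tau x)]]) 1
  = boundary_proper%:R * weight L.-1 0 c.
Proof.
rewrite /weight mulr_sumr.
have fixE s : fixed_above L.-1 s = [forall x, (lev x == L) ==> (s x == tau x)].
  by apply: eq_forallb => x; rewrite prednK// [(lev x == L)]eqn_leq level_le.
have -> : \sum_(s | admissible L.-1 c s) (boundary_proper%:R *
      \prod_(x | lev x == L.-1) cavity (kids 0 x) (s x)) =
   \sum_(s | admissible L.-1 c s)
     (boundary_proper && [forall x, forall y,
        [&& e x y, lev x == L.-1 & lev y == L] ==> (s x != tau y)])%:R :> R.
  apply: eq_bigr => s _; rewrite -mulnb natrM; congr (_ * _).
  transitivity (\prod_(x | lev x == L.-1) [forall y, (e x y && (lev y == L)) ==> (s x != tau y)]%:R : R).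
    apply: eq_bigr => x /eqP lx.
    rewrite /cavity /kids big_map big_filter big_enum_cond/= lx prednK//.
    case: (boolP [forall y, _]) => [/forallP h|].
      apply: big1 => y hy; rewrite ffunE; have := h y; rewrite hy/= => /negbTE ->.
      by rewrite subr0.
    rewrite negb_forall => /existsP[y]; rewrite negb_imply negbK => /andP[hy sy].
    by rewrite (bigD1 y)//= ffunE sy subrr mul0r.
  case: (boolP [forall x, _]) => [/forallP h|].
    apply: big1 => x lx; have /forallP hx := h x.
    suff -> : [forall y, (e x y && (lev y == L)) ==> (s x != tau y)] by [].
    by apply/forallP => y; have := hx y; rewrite lx.
  rewrite negb_forall => /existsP[x]; rewrite negb_forall => /existsP[y].
  rewrite negb_imply => /andP[/and3P[exy lx ly] sy].
  rewrite (bigD1 x)//= (_ : [forall y, _] = false) ?mul0r//.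
  by apply/negbTE; rewrite negb_forall; apply/existsP; exists y; rewrite exy ly.
have natb (b : bool) : b%:R = (if b then 1 else 0) :> R by case: b.
under [RHS]eq_bigr do rewrite natb.
rewrite -big_mkcondr; apply: eq_bigl => s.
rewrite /admissible -fixE.
case: (s u == c); rewrite /= ?andbF//.
case: (boolP (fixed_above _ s)); rewrite ?andbF//= => /forallP fs.
have fL x : lev x == L -> s x = tau x.
  by move=> lx; have := fs x; rewrite prednK// (eqP lx) leqnn => /eqP.
rewrite andbT; apply/forallP/and3P.
  move=> ps; have {}ps x y : e x y -> s x != s y by have /forallP/(_ y)/implyP := ps x.
  split; apply/forallP => x; apply/forallP => y; apply/implyP => /and3P[exy lx ly].
  - exact: ps.
  - by rewrite -!fL// ps.
  - by rewrite -(fL y)// ps.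
move=> [/forallP p1 /forallP p2 /forallP p3] x; apply/forallP => y; apply/implyP => exy.
have cases z : (lev z <= L.-1)%N \/ lev z == L.
  have := level_le e u L z; rewrite leq_eqVlt => /orP[->|]; first by right.
  by left; rewrite -ltnS prednK.
have near x' y' : e x' y' -> (lev x' <= L.-1)%N -> lev y' == L -> lev x' == L.-1.
  move=> exy' lx /eqP ly; have h : (lev y' <= (lev x').+1)%N by exact: level_step.
  by rewrite eqn_leq lx/= -ltnS prednK//; apply: leq_trans h; rewrite ly.
have [lx|lx] := cases x; have [ly|ly] := cases y.
- by have /forallP/(_ y) := p1 x; rewrite exy lx ly.
- rewrite (fL y)//; have /forallP/(_ y) := p3 x.
  by rewrite exy ly (near x y).
- rewrite eq_sym (fL x)//; have /forallP/(_ x) := p3 y.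
  by rewrite e_sym exy lx (near y x)// e_sym.
- by rewrite !fL//; have /forallP/(_ y) := p2 x; rewrite exy lx ly.
Qed.

(** Conditionally on the colours of level L, the law of the colour of the root is
    a message of depth L. *)
Lemma boundary_marginal :
  exists K (m : {ffun 'I_n.+1 -> R}), [/\ 0 <= K, message d L m &
  forall c, \sum_(s : {ffun T -> 'I_n.+1} |
     [&& proper_for e s, s u == c & [forall x, (lev x == L) ==> (s x == tau x)]]) 1
   = K * m c].
Proof.
have [|K K0 hK] := @weight_message L.-1 0; first by rewrite addn1 prednK.
exists (boundary_proper%:R * K), (msg L u); split.
- by rewrite mulr_ge0.
- by apply: msg_message; rewrite lev_u.
- by move=> c; rewrite boundary_count hK mulrA.
Qed.

End Elimination.

(** * The effect of one new edge *)

Lemma long_detours_sub (T : finType) (a e : rel T) g :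
  subrel e a -> long_detours a g -> long_detours e g.
Proof.
move=> ea ha x y p exy pp lp; apply: (ha x y p) => //; first exact: ea.
by apply: sub_path pp => s t /= /andP[/ea -> ->].
Qed.

(** A path from u to v in e, together with the edge uv of a, would be a cycle. *)
Lemma far_endpoint (T : finType) (a e : rel T) u v g L :
  (0 < L)%N -> (L.*2 <= g)%N -> subrel e a -> long_detours a g ->
  a u v -> ~~ e u v -> level e u L v = L.
Proof.
move=> L0 gL ea ha auv euv; apply/eqP; rewrite eqn_leq level_le leqNgt/=.
apply/negP => vL; have [p [pp lp sp _]] := descending_path vL.
have := ha u v p auv _ lp; rewrite sp => /(_ _)/wrap[]; last lia.
apply: sub_path pp => s t /= est; rewrite ea//=.
by apply: contra euv => /andP[/eqP <- /eqP <-].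
Qed.

(** Fix the colours of the vertices of level L.  The colour of v is then
    fixed, while that of u is nearly uniform, so u and v agree with probability
    about 1/q; summing over the colours of level L gives the claim. *)
Lemma monochromatic_ratio (R : realType) (T : finType) (a e : rel T) (u v : T)
    g L n d (eps : R) :
  symmetric e -> irreflexive e -> subrel e a -> long_detours a g ->
  a u v -> ~~ e u v -> (0 < L)%N -> (L.*2 <= g)%N ->
  (forall x, #|[set y | e x y]%SET| <= d.+1)%N ->
  (#|[set y | e u y]%SET| <= d)%N ->
  (0 < n)%N -> (d <= n.-1)%N ->
  (forall m : {ffun 'I_n.+1 -> R}, message d L m ->
     forall c, `|m c - n.+1%:R^-1| <= eps) ->
  `| \sum_(s : {ffun T -> 'I_n.+1} | proper_for e s && (s u == s v)) 1
     - n.+1%:R^-1 * \sum_(s : {ffun T -> 'I_n.+1} | proper_for e s) 1 |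
  <= eps * \sum_(s : {ffun T -> 'I_n.+1} | proper_for e s) 1.
Proof.
move=> e_sym e_irr ea ha auv euv L0 gL deg degu n0 dn hm.
have lv := far_endpoint L0 gL ea ha auv euv.
pose lev := level e u L.
(* The colours below level L are forgotten; ord0 is a placeholder. *)
pose restr (s : {ffun T -> 'I_n.+1}) : {ffun T -> 'I_n.+1} :=
  [ffun x => if lev x == L then s x else ord0].
rewrite (partition_big restr xpredT)//= [X in _ * X](partition_big restr xpredT)//=.
rewrite [X in eps * X](partition_big restr xpredT)//=.
rewrite !mulr_sumr -sumrB; apply: le_trans (ler_norm_sum _ _ _) _.
apply: ler_sum => r _.
have [rr|rr] := eqVneq (restr r) r; last first.
  have no s : restr s == r = false.
    apply/negP => /eqP sr; move/eqP: rr; apply; rewrite -sr.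
    by apply/ffunP => x; rewrite !ffunE; case: (lev x == L).
  have no0 (P : pred {ffun T -> 'I_n.+1}) :
      \sum_(s | P s && (restr s == r)) 1 = 0 :> R.
    by rewrite big_pred0// => s; rewrite no andbF.
  by rewrite !no0 !mulr0 subrr normr0.
have agree s : (restr s == r) = [forall x, (lev x == L) ==> (s x == r x)].
  apply/eqP/forallP => [<- x|h].
    by apply/implyP => lx; rewrite ffunE lx.
  apply/ffunP => x; rewrite -rr !ffunE; case: ifP => // lx.
  by have := h x; rewrite lx => /eqP.
have parentP x w y : (0 < level e u L x < L)%N ->
  e w x -> (level e u L w < level e u L x)%N ->
  e x y -> (level e u L y <= level e u L x)%N -> y = w.
  by apply: unique_parent gL => //; exact: long_detours_sub ha.
have [K [m [K0 hmm hK]]] :=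
  @boundary_marginal R T e u L n d r e_sym e_irr parentP L0 deg degu n0 dn.
have [_ m1] := message_distribution n0 dn hmm.
have -> : \sum_(i | proper_for e i && (i u == i v) && (restr i == r)) 1 = K * m (r v).
  rewrite -hK; apply: eq_bigl => s; rewrite agree -andbA.
  case: (proper_for e s) => //=; apply/andP/andP => -[h1 h2]; split=> //.
    by have /forallP/(_ v) := h2; rewrite /lev lv eqxx/= => /eqP <-.
  by have /forallP/(_ v) := h2; rewrite /lev lv eqxx/= => /eqP ->.
have -> : \sum_(i | proper_for e i && (restr i == r)) 1 = K.
  rewrite -[RHS]mulr1 -[X in _ = _ * X]m1 mulr_sumr.
  rewrite (partition_big (fun s : {ffun T -> 'I_n.+1} => s u) xpredT)//=.
  apply: eq_bigr => c _; rewrite -hK; apply: eq_bigl => s.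
  by rewrite agree andbAC andbA.
rewrite mulrC -mulrBl normrM (ger0_norm K0) ler_wpM2r//; exact: hm.
Qed.

(** * Building the graph edge by edge *)

Lemma girth_cycle (R : realType) (G : sgraph) g (c : seq G) :
  ((g%:R)%:E <= girth R G)%E -> graph_cycle c -> (g <= size c)%N.
Proof.
move=> hg hc; rewrite -(@ler_nat R) -lee_fin; apply: le_trans hg _.
by apply: ereal_inf_lbound; exists c.
Qed.

Lemma long_detours_girth (R : realType) (G : sgraph) g :
  ((g%:R)%:E <= girth R G)%E -> long_detours (@adj G) g.
Proof.
move=> hg x y p axy pp; case/shortenP: pp => p' pp' up' /(uniq_leq_size (proj2 (andP up'))) sp ly.
apply: leq_trans (_ : size (x :: p') <= _)%N; last by rewrite /= ltnS sp.
apply: (girth_cycle hg); split.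
  case: p' pp' up' ly {sp} => [|z [|w p']]//=.
    by move=> _ _ xy; rewrite xy adj_irr in axy.
  by move=> /andP[/andP[_ /negP h] _] _ zy; case: h; rewrite zy !eqxx.
apply/andP; split; last exact: up'.
rewrite /path.cycle rcons_path ly adj_sym axy andbT.
by apply: sub_path pp' => s t /= /andP[].
Qed.

Definition edge_rel (T : eqType) (s : seq (T * T)) : rel T :=
  [rel x y | ((x, y) \in s) || ((y, x) \in s)].

Definition count_proper (R : realType) (T : finType) (e : rel T) q : R :=
  \sum_(s : {ffun T -> 'I_q} | proper_for e s) 1.

Lemma count_proper_nil (R : realType) (T : finType) q :
  count_proper R (edge_rel ([::] : seq (T * T))) q = q%:R ^+ #|T|.
Proof.
rewrite /count_proper (eq_bigl xpredT) => [|s]; last first.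
  by apply/forallP => x; apply/forallP => y.
by rewrite sumr_const -natrX card_ffun card_ord.
Qed.

Lemma proper_for_cons (T : finType) q u v (s : seq (T * T)) (f : {ffun T -> 'I_q}) :
  proper_for (edge_rel ((u, v) :: s)) f =
  proper_for (edge_rel s) f && (f u != f v).
Proof.
apply/forallP/andP => [h|[/forallP h uv] x].
  split; last by have /forallP/(_ v) := h u; rewrite /edge_rel/= inE eqxx.
  apply/forallP => x; apply/forallP => y; apply/implyP => /orP exy.
  have /forallP/(_ y)/implyP := h x; apply.
  by rewrite /edge_rel/= !inE; case: exy => ->; rewrite !orbT.
apply/forallP => y; apply/implyP; rewrite /edge_rel/= !inE.
rewrite !xpair_eqE orbACA => /orP[/orP[]/andP[/eqP -> /eqP ->]|exy].
- by [].
- by rewrite eq_sym.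
- by have /forallP/(_ y) := h x; rewrite /edge_rel/= exy.
Qed.

Lemma count_proper_cons (R : realType) (T : finType) q u v (s : seq (T * T)) :
  count_proper R (edge_rel ((u, v) :: s)) q = count_proper R (edge_rel s) q
  - \sum_(f : {ffun T -> 'I_q} | proper_for (edge_rel s) f && (f u == f v)) 1.
Proof.
rewrite /count_proper [in RHS](bigID (fun f : {ffun T -> 'I_q} => f u == f v))/=.
by rewrite addrAC subrr add0r; apply: eq_bigl => f; rewrite proper_for_cons.
Qed.

Section Telescope.
Variables (R : realType) (G : sgraph) (g L n d : nat) (eps : R).
Hypothesis reg : regular d.+1 G.
Hypothesis hg : long_detours (@adj G) g.
Hypotheses (L0 : (0 < L)%N) (gL : (L.*2 <= g)%N).
Hypotheses (n0 : (0 < n)%N) (dn : (d <= n.-1)%N).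
Hypothesis hm : forall m : {ffun 'I_n.+1 -> R}, message d L m ->
     forall c, `|m c - n.+1%:R^-1| <= eps.
Hypothesis eps_le : eps <= 1 - n.+1%:R^-1.

Definition oriented (p : G * G) := adj p.1 p.2 && (enum_rank p.1 < enum_rank p.2)%N.

Lemma telescope (s : seq (G * G)) : uniq s -> all oriented s ->
  (1 - n.+1%:R^-1 - eps) ^+ size s * n.+1%:R ^+ #|G| <= count_proper R (edge_rel s) n.+1
    <= (1 - n.+1%:R^-1 + eps) ^+ size s * n.+1%:R ^+ #|G|.
Proof.
have e0 : 0 <= eps.
  have hmsg : forall j, exists m : {ffun 'I_n.+1 -> R}, message d j m.
    elim=> [|j [m hj]]; first by eexists; constructor; exact: (point_distribution R (ord0 : 'I_n.+1)).
    by exists (bp [::]); constructor.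
  have [m /hm /(_ ord0)] := hmsg L; exact: le_trans.
elim: s => [|[u v] s IH] /=.
  by rewrite count_proper_nil mul1r lexx.
move=> /andP[uvs us] /andP[/andP[/= auv ruv] os].
have ors x y : (x, y) \in s -> adj x y /\ (enum_rank x < enum_rank y)%N.
  by move=> xys; have /andP[] := allP os _ xys.
have ea : subrel (edge_rel s) (@adj G).
  by move=> x y /orP[/ors[]//|/ors[]]; rewrite adj_sym.
have e_sym : symmetric (edge_rel s) by move=> x y; rewrite /edge_rel/= orbC.
have e_irr : irreflexive (edge_rel s).
  by move=> x; apply/negP => /ea; rewrite adj_irr.
have euv : ~~ edge_rel s u v.
  rewrite /edge_rel/= (negbTE uvs)/=; apply/negP => /ors[_].
  by rewrite ltnNge ltnW.
have deg x : (#|[set y | edge_rel s x y]%SET| <= d.+1)%N.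
  rewrite -(reg x); apply: subset_leq_card; apply/fintype.subsetP => y.
  by rewrite !inE => /ea.
have degu : (#|[set y | edge_rel s u y]%SET| <= d)%N.
  rewrite -ltnS -(reg u); apply: proper_card; apply/properP; split.
    by apply/fintype.subsetP => y; rewrite !inE => /ea.
  by exists v; rewrite !inE.
have := monochromatic_ratio e_sym e_irr ea hg auv euv L0 gL deg degu n0 dn hm.
have /andP[] := IH us os.
rewrite count_proper_cons -/(count_proper R (edge_rel s) n.+1).
set Z := count_proper R _ _; set D := \sum_(_ | _) 1; set P := _ ^+ #|G|.
move=> lo hi; rewrite ler_norml => /andP[h1 h2].
have Z0 : 0 <= Z by rewrite sumr_ge0.
have aux (i : R) : - (eps * Z) <= D - i * Z -> D - i * Z <= eps * Z ->
  (1 - i - eps) * Z <= Z - D /\ Z - D <= (1 - i + eps) * Z by move=> *; split; lra.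
have [h3 h4] := aux _ h1 h2.
rewrite !exprS -!mulrA; apply/andP; split.
  apply: (@le_trans _ _ ((1 - n.+1%:R^-1 - eps) * Z)); last exact: h3.
  by apply: ler_wpM2l => //; rewrite subr_ge0.
apply: (@le_trans _ _ ((1 - n.+1%:R^-1 + eps) * Z)); first exact: h4.
by apply: ler_wpM2l => //; rewrite addr_ge0// (le_trans e0).
Qed.

End Telescope.

Definition edges (G : sgraph) := [seq p <- enum {: G * G} | oriented p].

Lemma mem_edges (G : sgraph) (p : G * G) : (p \in edges G) = oriented p.
Proof. by rewrite mem_filter mem_enum andbT. Qed.

Lemma edge_rel_edges (G : sgraph) : edge_rel (edges G) =2 @adj G.
Proof.
move=> x y; rewrite /edge_rel/= !mem_edges /oriented/= [adj y x]adj_sym.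
rewrite -andb_orr; have [xy|xy] := boolP (adj x y) => //=.
have : x != y by apply: contraTneq xy => ->; rewrite adj_irr.
by rewrite -(inj_eq enum_rank_inj) neq_ltn.
Qed.

Lemma handshake (G : sgraph) r : regular r G -> ((size (edges G)).*2 = #|G| * r)%N.
Proof.
move=> reg.
have -> : size (edges G) = \sum_(p : G * G | oriented p) 1.
  by rewrite /edges size_filter -sum1_count big_enum_cond.
have <- : (\sum_(p : G * G | adj p.1 p.2) 1 = #|G| * r)%N.
  rewrite -(pair_big_dep xpredT (fun x y : G => adj x y) (fun _ _ => 1%N))/=.
  rewrite (eq_bigr (fun _ => r)) ?sum_nat_const// => x _.
  by rewrite sum1_card -(reg x); apply: eq_card => y; rewrite !inE.
rewrite [RHS](bigID (fun p : G * G => enum_rank p.1 < enum_rank p.2)%N)/= -addnn.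
congr (_ + _)%N.
rewrite (reindex (fun p : G * G => (p.2, p.1))); last first.
  by exists (fun p => (p.2, p.1)) => -[].
apply: eq_bigl => -[x y]; rewrite /oriented/= [adj y x]adj_sym.
have [xy|//] := boolP (adj x y); rewrite /= -leqNgt.
apply/idP/idP => [/ltnW//|]; rewrite leq_eqVlt => /orP[/eqP|//].
by move=> /ord_inj/enum_rank_inj yx; rewrite yx adj_irr in xy.
Qed.

Lemma count_proper_edges (R : realType) (G : sgraph) q :
  count_proper R (edge_rel (edges G)) q = (num_colorings q G)%:R.
Proof.
rewrite /count_proper /num_colorings -sumr_const; apply: eq_bigl => f.
rewrite inE; apply: eq_forallb => x; apply: eq_forallb => y.
by rewrite edge_rel_edges.
Qed.

(** * From edge ratios to the density of the logarithm *)

(** The error x c0 in the factor c0 = 1 - 1/q of each edge is chosen such that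
    r / 2 times ln (1 + x) or - ln (1 - x) is at most delta. *)
Lemma log_density_close (R : realType) (r q : nat) (delta : R) :
  (1 <= r)%N -> (r + 1 <= q)%N -> 0 < delta ->
  exists g0, forall g N (G : sgraph), (g0 <= g)%N -> (1 <= N)%N -> graph_class R N g r G ->
    `| ln ((num_colorings q G)%:R : R) / N%:R
       - ln (q%:R * (1 - 1 / q%:R) `^ (r%:R / 2)) | <= delta.
Proof.
case: r => [//|d] _; case: q => [|n]; first by rewrite addn1.
rewrite addn1 ltnS => dn delta0.
have n0 : (0 < n)%N by apply: leq_trans dn.
have dn' : (d <= n.-1)%N by rewrite -ltnS prednK.
pose Q : R := n.+1%:R; rewrite -/Q.
have Q1 : 1 < Q by rewrite /Q ltr1n.
have Q0 : 0 < Q by lra.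
pose c0 := 1 - Q^-1.
have c00 : 0 < c0 by rewrite subr_gt0 invf_lt1.
pose r : R := d.+1%:R; rewrite -/r.
have r0 : 0 < r by rewrite ltr0n.
pose x := Num.min 2^-1 (delta / r).
have x0 : 0 < x by rewrite lt_min divr_gt0// invr_gt0 ltr0n.
have x1 : x <= 2^-1 by rewrite ge_min lexx.
have xr : x * r <= delta by rewrite -ler_pdivlMr// ge_min lexx orbT.
have eps0 : 0 < x * c0 by rewrite mulr_gt0.
(* Depth L = J.+1 suffices, and needs girth at least 2 L. *)
have [J hJ] := message_converges n0 dn' eps0.
exists J.+1.*2 => g N G hg N1 [cardG reg hgirth].
have eps_le : x * c0 <= 1 - n.+1%:R^-1.
  by rewrite -/Q -/c0 -[leRHS]mul1r ler_pM2r//; lra.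
have uE : uniq (edges G) by rewrite filter_uniq// enum_uniq.
have oE : all (@oriented G) (edges G) by apply: filter_all.
have := telescope reg (long_detours_girth hgirth) (ltn0Sn J) hg n0 dn'
  (fun m hm => hJ _ m (leqnSn J) hm) eps_le uE oE.
rewrite count_proper_edges cardG -/Q -/c0.
set Z : R := _%:R; set m := size _.
have -> : c0 - x * c0 = c0 * (1 - x) by lra.
have -> : c0 + x * c0 = c0 * (1 + x) by lra.
have mN : m%:R * 2 = N%:R * r.
  by rewrite -!natrM muln2 (handshake reg) cardG.
have N0 : 0 < N%:R :> R by rewrite ltr0n.
have xm : 0 < 1 - x by lra.
have xp : 0 < 1 + x by lra.
have lnE y : 0 < y -> ln ((c0 * y) ^+ m * Q ^+ N) = m%:R * (ln c0 + ln y) + N%:R * ln Q.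
  move=> y0; have cy : 0 < c0 * y by rewrite mulr_gt0.
  rewrite lnM ?posrE ?exprn_gt0// !lnXn// lnM ?posrE//.
  by rewrite mulr_natl [in RHS]mulr_natl.
move=> /andP[lo hi].
have P0 : 0 < (c0 * (1 - x)) ^+ m * Q ^+ N by rewrite mulr_gt0 ?exprn_gt0// mulr_gt0.
have Z0 : 0 < Z by apply: lt_le_trans lo.
have {}lo : m%:R * (ln c0 + ln (1 - x)) + N%:R * ln Q <= ln Z.
  by rewrite -lnE// ler_ln ?posrE.
have {}hi : ln Z <= m%:R * (ln c0 + ln (1 + x)) + N%:R * ln Q.
  by rewrite -lnE// ler_ln ?posrE// (lt_le_trans Z0).
have -> : ln (Q * (1 - 1 / Q) `^ (r / 2)) = ln Q + r / 2 * ln c0.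
  by rewrite div1r -/c0 lnM ?posrE ?powR_gt0// ln_powR.
have lx : ln (1 + x) <= x by apply: le_ln1Dx; lra.
have lmx : - (2 * x) <= ln (1 - x).
  have := ln_1B_lower (ltW x0) (_ : x < 1) (lexx x).
  move=> /(_ ltac:(lra)); apply: le_trans.
  rewrite expr2 -subr_ge0.
  have -> : - x - x * x / (2 * (1 - x)) - - (2 * x) = x * (2 - 3 * x) / (2 * (1 - x)).
    by field; rewrite gt_eqF.
  by rewrite divr_ge0 ?mulr_ge0//; lra.
have mE : m%:R = N%:R * (r / 2) by lra.
rewrite mE in lo hi.
have r2 : 0 < r / 2 by rewrite divr_gt0.
rewrite ler_norml; apply/andP; split.
  rewrite lerBrDr ler_pdivlMr//.
  apply: le_trans lo.
  have : N%:R * (r / 2) * - (2 * x) <= N%:R * (r / 2) * ln (1 - x).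
    by apply: ler_wpM2l => //; rewrite mulr_ge0 ?ltW.
  have : N%:R * (x * r) <= N%:R * delta by apply: ler_wpM2l => //; rewrite ltW.
  lra.
rewrite lerBlDr ler_pdivrMr//.
apply: le_trans hi _.
have : N%:R * (r / 2) * ln (1 + x) <= N%:R * (r / 2) * x.
  by apply: ler_wpM2l => //; rewrite mulr_ge0 ?ltW.
have : N%:R * (x * r) <= N%:R * delta by apply: ler_wpM2l => //; rewrite ltW.
have : 0 <= N%:R * (x * r) by rewrite !mulr_ge0 ?ltW.
lra.
Qed.

Lemma cvg_ereal0 (R : realType) (f : nat -> \bar R) :
  (forall g, 0 <= f g)%E ->
  (forall delta : R, 0 < delta -> exists g0, forall g, (g0 <= g)%N -> (f g <= delta%:E)%E) ->
  f @ \oo --> (0 : \bar R).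
Proof.
move=> f0 fs.
have fin g0 delta g : (forall g, (g0 <= g)%N -> (f g <= (delta : R)%:E)%E) ->
    (g0 <= g)%N -> f g \is a fin_num.
  move=> h /h hg; rewrite ge0_fin_numE//; exact: le_lt_trans hg (ltry _).
apply/fine_cvgP; split.
  by have [g0 hg0] := fs 1 ltr01; exists g0 => // g /= /(fin _ _ _ hg0).
apply/cvgrPdist_le => delta delta0; have [g0 hg0] := fs _ delta0.
exists g0 => // g /= gg; rewrite sub0r normrN ger0_norm ?fine_ge0//.
by rewrite -lee_fin fineK ?hg0//; exact: fin hg0 gg.
Qed.

(** * Regular graphs of large girth *)

(** Biggs' construction.  Reduced words over r letters of length at most g form the
    ball of radius g in the r-regular tree whose edges are properly coloured by the
    letters.  The letter i acts on this ball by exchanging the ends of the edges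
    of colour i.  In the group of all permutations of the ball, a reduced
    product of at most g letters moves the root, hence is not trivial, and short
    cycles in the Cayley graph of these involutions would give such trivial
    products. *)
Section LargeGirth.
Variables (r g : nat).

Definition reduced (s : seq 'I_r) := sorted (fun i j => i != j) s.

Record word := Word { letters : g.-bseq 'I_r; letters_reduced : reduced letters }.

HB.instance Definition _ := [isSub for letters].
HB.instance Definition _ := [Finite of word by <:].

(** Crosses the edge of colour i at the vertex s, and stays at s when this edge
    leaves the ball. *)
Definition toggle_seq (i : 'I_r) (s : seq 'I_r) : seq 'I_r :=
  if s is j :: s' then
    if j == i then s' else if (size s < g)%N then i :: s else s
  else if (0 < g)%N then [:: i] else s.

Lemma toggle_size i s : (size s <= g)%N -> (size (toggle_seq i s) <= g)%N.
Proof.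
case: s => [|j s] /=; first by case: ifP.
by move=> h; case: eqP => _; [exact: ltnW | case: ifP].
Qed.

Lemma toggle_reduced i s : reduced s -> reduced (toggle_seq i s).
Proof.
case: s => [|j s] /=; first by case: ifP.
move=> h; case: eqP => [_|ij]; first exact: path_sorted h.
by case: ifP => // _; rewrite /reduced/= h andbT eq_sym; apply/eqP.
Qed.

Lemma toggleK i s : reduced s -> (size s <= g)%N -> toggle_seq i (toggle_seq i s) = s.
Proof.
case: s => [|j s] /=; first by case: (ltnP 0 g) => h _ _ /=; rewrite ?eqxx// ltnNge h.
rewrite /reduced/= => h sg; case: (eqVneq j i) => [ji|ij].
  subst j; case: s h sg => [|k s] /= h sg; first by rewrite sg.
  have /andP[ik _] := h; rewrite eq_sym (negbTE ik).
  by rewrite sg.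
case: (ltnP (size s).+1 g) => hg /=; first by rewrite eqxx.
by rewrite (negbTE ij) ltnNge hg.
Qed.

Definition toggle (i : 'I_r) (w : word) : word :=
  Word (letters := Bseq (toggle_size i (size_bseq (letters w))))
       (toggle_reduced i (letters_reduced w)).

Lemma toggle_involutive i : involutive (toggle i).
Proof.
move=> w; apply/val_inj/val_inj => /=.
by rewrite toggleK ?size_bseq ?letters_reduced.
Qed.

Definition gen i : {perm word} := perm (inv_inj (toggle_involutive i)).

Definition cayley_adj (x y : {perm word}) := [exists i, y == (x * gen i)%g].

Lemma gen_mulK x i : (x * gen i * gen i)%g = x.
Proof.
apply/permP => w; rewrite !permM !permE; exact: toggle_involutive.
Qed.

Lemma cayley_sym : symmetric cayley_adj.
Proof.
move=> x y; apply/existsP/existsP => -[i /eqP ->]; exists i; by rewrite gen_mulK.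
Qed.

Definition empty_word : word := Word (letters := @Bseq g _ [::] (leq0n g)) isT.

Definition act (p : seq 'I_r) : {perm word} := foldr (fun i x => gen i * x)%g 1%g p.

Lemma toggle_push (i : 'I_r) s : path (fun i j => i != j) i s -> (size s < g)%N ->
  toggle_seq i s = i :: s.
Proof.
case: s => [|j s] /=; first by move=> _ ->.
by move=> /andP[ij _] ->; rewrite eq_sym (negbTE ij).
Qed.

(** A reduced product pushes its letters onto the word one after the other. *)
Lemma act_letters (p : seq 'I_r) w : reduced (rev p ++ letters w) ->
  (size p + size (letters w) <= g)%N -> letters (act p w) = rev p ++ letters w :> seq _.
Proof.
elim: p w => [|i p IH] w /=; first by rewrite perm1.
rewrite rev_cons cat_rcons => red sz.
have tE : letters (gen i w) = i :: letters w :> seq _.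
  rewrite permE /= toggle_push//; last by rewrite (leq_trans _ sz)// addSn ltnS leq_addl.
  by have [_] := cat_sorted2 red.
by rewrite permM IH tE//= -addSnnS.
Qed.

Lemma act_neq1 (p : seq 'I_r) : (0 < size p <= g)%N -> reduced p -> act p != 1%g.
Proof.
move=> /andP[p0 pg] red; apply/eqP => p1.
have := @act_letters p empty_word; rewrite cats0 addn0 p1 perm1 => /(_ _ pg)/=.
rewrite /reduced rev_sorted (@eq_sorted _ _ (fun i j => i != j)); last by move=> i j; rewrite eq_sym.
move=> /(_ red) h; move: p0; by rewrite -size_rev -h.
Qed.

Lemma gen_inj : (0 < g)%N -> injective gen.
Proof.
move=> g0 i j gij; have := congr1 (fun s : {perm word} => ohead (letters (s empty_word))) gij.
by rewrite !permE /= g0 => -[].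
Qed.

Lemma cayley_irr : (0 < g)%N -> irreflexive cayley_adj.
Proof.
move=> g0 x; apply/existsP => -[i /eqP xi].
have := @act_neq1 [:: i]; rewrite /= g0 => /(_ isT isT); rewrite mulg1 => /eqP; apply.
by apply: (mulgI x); rewrite mulg1 -xi.
Qed.

Lemma cayley_walk (x : {perm word}) p : path cayley_adj x p ->
  exists w, p = scanl (fun y i => y * gen i)%g x w.
Proof.
elim: p x => [|y p IH] x /=; first by exists [::].
move=> /andP[/existsP[i /eqP ->] /IH[w ->]]; by exists (i :: w).
Qed.

Lemma last_walk (x : {perm word}) w :
  last x (scanl (fun y i => y * gen i)%g x w) = (x * act w)%g.
Proof. by elim: w x => [|i w IH] x /=; rewrite ?mulg1// IH mulgA. Qed.

Lemma simple_walk_reduced (x : {perm word}) w :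
  uniq (x :: scanl (fun y i => y * gen i)%g x w) -> reduced w.
Proof.
elim: w x => [//|i [|j w] IH] x //= /andP[xn /= un].
apply/andP; split; last exact: (IH (x * gen i)%g).
by apply: contraNneq xn => ->; rewrite !inE gen_mulK eqxx orbT.
Qed.

Definition cayley_graph (g0 : (0 < g)%N) : sgraph := SGraph cayley_sym (cayley_irr g0).

Lemma cayley_regular (g0 : (0 < g)%N) : regular r (cayley_graph g0).
Proof.
move=> x; rewrite -[RHS]card_ord -(card_imset _ (_ : injective (fun i => x * gen i)%g)).
  by apply: eq_card => y; rewrite !inE; apply/existsP/imsetP => [[i /eqP ->]|[i _ ->]]; exists i.
by move=> i j /mulgI /(gen_inj g0).
Qed.

(** Removing the last step of a cycle leaves a simple walk, with a reduced
    label w of length at least 2 whose action equals that of one letter.  They move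
    the root to distances size w and 1, which is impossible if size w <= g. *)
Lemma cayley_cycle (g0 : (0 < g)%N) (c : seq (cayley_graph g0)) :
  graph_cycle c -> (g <= size c)%N.
Proof.
case: c => [[]//|x p] [sp /andP[cp up]].
have : path cayley_adj x (rcons p x) by exact: cp.
rewrite rcons_path => /andP[px lx].
rewrite leqNgt; apply/negP => pg.
have [w pw] := cayley_walk px.
have sw : size w = size p by rewrite pw size_scanl.
have red : reduced w by apply: (@simple_walk_reduced x); rewrite -pw.
have /existsP[i /eqP xi] := lx.
have aw : act w = gen i.
  apply: (mulgI x); rewrite -last_walk -pw [in RHS]xi.
  by rewrite gen_mulK.
have rw : reduced (rev w ++ [::]).
  by rewrite cats0 /reduced rev_sorted; apply: sub_sorted red => a b; rewrite eq_sym.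
have := @act_letters w empty_word rw; rewrite /= addn0 sw => /(_ (ltnW (ltnW pg))).
rewrite aw permE /= g0 cats0 => /(congr1 size); rewrite size_rev sw => /= sp1.
by move: sp; rewrite /= -sp1.
Qed.

End LargeGirth.

Lemma exists_regular_large_girth (R : realType) (r g : nat) :
  exists (n : nat) (G : sgraph), (1 <= n)%N /\ graph_class R n g r G.
Proof.
exists #|cayley_graph r (ltn0Sn g)|, (cayley_graph r (ltn0Sn g)); split.
  by apply/card_gt0P; exists (1%g : {perm _}).
split=> //; first exact: cayley_regular.
apply: le_ereal_inf_tmp => _ [c hc <-].
by rewrite lee_fin ler_nat; apply: ltnW; exact: cayley_cycle hc.
Qed.

Theorem theorem4 (R : realType) (r q : nat) (hr : (1 <= r)%N)
    (hq : (r + 1 <= q)%N) :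
  (fun g : nat =>
     ereal_sup
       [set d : \bar R | exists (n : nat) (G : sgraph),
          [/\ (1 <= n)%N, graph_class R n g r G &
              d = (`| ln ((num_colorings q G)%:R : R) / n%:R
                      - ln (q%:R * (1 - 1 / q%:R) `^ (r%:R / 2)) |)%:E]])
    @ \oo --> (0 : \bar R).
Proof.
apply: cvg_ereal0 => [g|delta delta0].
  have [n [G [n1 hG]]] := exists_regular_large_girth R r g.
  apply: le_trans (ereal_sup_ubound _); last by exists n, G; split.
  by rewrite lee_fin.
have [g0 hg0] := log_density_close hr hq delta0.
exists g0 => g gg; apply: ge_ereal_sup => _ [n [G [n1 hG ->]]].
by rewrite lee_fin; exact: (hg0 g).
Qed.
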